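(* Write $J_\lambda(\alpha)=\sum_\mu v_{\lambda\mu}(\alpha)m_\mu$ and $Q_\mu(\alpha)=\sum_\lambda C_{\mu\lambda}(\alpha)q_\lambda(\alpha)$. Then for partitions $\mu<\lambda$, $$v_{\lambda\mu}(\alpha)=v_{\lambda\lambda}(\alpha)\sum_\delta f^\lambda(\delta),\qquad C_{\mu\lambda}(\alpha)=C_{\mu\mu}(\alpha)\sum_\delta f_\mu(\delta),$$ where both sums run over all moving up filtrations $\delta$ of partitions starting from $\mu$ and ending at $\lambda$.
   Context: $F=\mathbb{Q}(\alpha)$, $\Lambda_F=F[p_1,p_2,\dots]$ ($p_n$ power sums), $m_\mu$ monomial symmetric functions. For a partition $\lambda$: $l(\lambda)$ number of parts, $\lambda'$ conjugate, $m_a(\lambda)$ number of parts equal to $a$, $z_\lambda=\prod_ii^{m_i(\lambda)}m_i(\lambda)!$. Dominance order $\le$. Scalar product $\langle p_\lambda,p_\mu\rangle=\delta_{\lambda\mu}\alpha^{l(\lambda)}z_\lambda$. Jack $P_\lambda(\alpha)$: the pairwise orthogonal functions of the form $m_\lambda+\sum_{\mu<\lambda}c_{\lambda\mu}m_\mu$; $Q_\lambda=\langle P_\lambda,P_\lambda\rangle^{-1}P_\lambda$; $J_\lambda=\big(\prod_{(i,j)\in\lambda}(\alpha(\lambda_i-j)+\lambda'_j-i+1)\big)P_\lambda$. $Q_n(\alpha)=\sum_{\lambda\vdash n}\alpha^{-l(\lambda)}z_\lambda^{-1}p_\lambda$ ($Q_0=1$), $q_\lambda=Q_{\lambda_1}Q_{\lambda_2}\cdots$.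 $e'_\lambda(\alpha)=\frac12\alpha\sum_i\lambda_i^2-\sum_ii\lambda_i$. Moving up operator: for $i<j$ and $0<k\le\lambda_j$, $r^i_j(k).\lambda$ is the rearrangement in decreasing order of $(\lambda_1,\dots,\lambda_i+k,\dots,\lambda_j-k,\dots)$; $M^*(\lambda)$ is the set of all such. For $\mu=r^i_j(k).\lambda$, $r_{\lambda\mu}=(1+\delta_{\lambda_i\lambda_j})^{-1}m_{\lambda_i}(\lambda)(m_{\lambda_j}(\lambda)-\delta_{\lambda_i\lambda_j})(\lambda_i-\lambda_j+2k)$. A moving up filtration from $\lambda^0$ to $\lambda^s$ is a sequence $\delta=(\lambda^0,\lambda^1,\dots,\lambda^s)$ with $\lambda^i\in M^*(\lambda^{i-1})$ for $i=1,\dots,s$. For such $\delta$ and $\lambda\ge\lambda^s$, $\mu\le\lambda^0$: $$f^\lambda(\delta)=\prod_{i=0}^{s-1}\frac{r_{\lambda^i\lambda^{i+1}}}{e'_\lambda(\alpha)-e'_{\lambda^i}(\alpha)},\qquad f_\mu(\delta)=\prod_{i=0}^{s-1}\frac{r_{\lambda^i\lambda^{i+1}}}{e'_\mu(\alpha)-e'_{\lambda^{i+1}}(\alpha)}.$$ *)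

(* Defs.v *)
From HB Require Import structures.
From mathcomp Require Import all_boot all_order all_algebra.
From mathcomp Require Import fraction.
From mathcomp Require Import mpoly.
Set Implicit Arguments. Unset Strict Implicit. Unset Printing Implicit Defensive.
Import Order.TTheory GRing.Theory Num.Theory.
Local Open Scope ring_scope.

Definition F : fieldType := {fraction {poly rat}}.
Definition alpha : F := @FracField.tofrac _ ('X : {poly rat}).

Definition is_partition (s : seq nat) : bool :=
  sorted geq s && all (fun x => 0 < x)%N s.
Definition is_partition_of (n : nat) (s : seq nat) : bool :=
  is_partition s && (sumn s == n).

(* all partitions of n: every partition of n has <= n parts, each <= n,
   so it is obtained from an n-tuple over {0..n} by dropping zeros *)
Definition partitions (n : nat) : seq (seq nat) :=
  undup [seq s <- [seq [seq x <- map val (tval t) | (0 < x)%N]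
                  | t <- enum {: n.-tuple 'I_n.+1}]
        | is_partition_of n s].

Definition plen (la : seq nat) : nat := size la.
Definition mult (a : nat) (la : seq nat) : nat := count_mem a la.
Definition zee (la : seq nat) : nat :=
  \prod_(a <- undup la) (a ^ mult a la * (mult a la)`!)%N.

(* conjugate: la'_j (1-indexed j) = #{i | la_i >= j} *)
Definition conjp (la : seq nat) (j : nat) : nat := count (fun x => j <= x)%N la.

Definition dom_le (mu la : seq nat) : bool :=
  (sumn mu == sumn la) &&
  all (fun k => sumn (take k mu) <= sumn (take k la))%N
      (iota 0 (size mu + size la).+1).
Definition dom_lt (mu la : seq nat) : bool := dom_le mu la && (mu != la).

(* ---------- Lambda_F in degree <= n:  F[p_1, ..., p_n] ----------
   variable 'X_i (i : 'I_n) stands for the power sum p_(i+1). *)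
Definition pvar (n k : nat) : {mpoly F[n]} :=
  if insub k.-1 is Some i then 'X_i else 0.
Definition pla (n : nat) (la : seq nat) : {mpoly F[n]} :=
  \prod_(a <- la) pvar n a.

(* weight (= degree in Lambda) of a p-monomial *)
Definition pweight (n : nat) (m : 'X_{1..n}) : nat :=
  (\sum_(i < n) i.+1 * m i)%N.
Definition homog_deg (n d : nat) (f : {mpoly F[n]}) : Prop :=
  forall m, m \in msupp f -> pweight m = d.

(* <p_la, p_mu> = delta alpha^l(la) z_la ; a p-monomial m encodes the
   partition with m_(i+1) = m i, so l = mdeg m, z = prod (i+1)^(m i) (m i)! *)
Definition zmon (n : nat) (m : 'X_{1..n}) : nat :=
  (\prod_(i < n) (i.+1 ^ m i * (m i)`!))%N.
Definition scal (n : nat) (f g : {mpoly F[n]}) : F :=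
  \sum_(m <- msupp f) f@_m * g@_m * (alpha ^+ mdeg m * (zmon m)%:R).

(* ---------- realization as symmetric polynomials in x_1..x_n ---------- *)
Definition psum (n k : nat) : {mpoly F[n]} := \sum_(i < n) 'X_i ^+ k.
Definition ev (n : nat) (f : {mpoly F[n]}) : {mpoly F[n]} :=
  f \mPo [tuple psum n i.+1 | i < n].

Definition mpart (n : nat) (m : 'X_{1..n}) : seq nat :=
  sort geq [seq x <- [seq m i | i <- enum 'I_n] | (0 < x)%N].
(* monomial symmetric function m_mu in x_1..x_n (for |mu| <= n) *)
Definition mono (n : nat) (mu : seq nat) : {mpoly F[n]} :=
  \sum_(m : 'X_{1..n < n.+1} | mpart m == mu) 'X_[(m : 'X_{1..n})].

Definition jackP_family (n : nat) (P : seq nat -> {mpoly F[n]}) : Prop :=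
  (forall la, la \in partitions n -> homog_deg n (P la)) /\
  (forall la, la \in partitions n -> exists c : seq nat -> F,
      ev (P la) = mono n la +
                  \sum_(mu <- partitions n | dom_lt mu la) c mu *: mono n mu) /\
  (forall la mu, la \in partitions n -> mu \in partitions n -> la != mu ->
      scal (P la) (P mu) = 0).

Definition jprod (la : seq nat) : F :=
  \prod_(i < size la) \prod_(j < nth 0%N la i)
     (alpha * ((nth 0%N la i)%:R - (j.+1)%:R) + (conjp la j.+1)%:R - (i.+1)%:R + 1).
Definition Jj (n : nat) (P : seq nat -> {mpoly F[n]}) (la : seq nat) : {mpoly F[n]} :=
  jprod la *: P la.
Definition Qj (n : nat) (P : seq nat -> {mpoly F[n]}) (la : seq nat) : {mpoly F[n]} :=
  (scal (P la) (P la))^-1 *: P la.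

Definition Qn (n k : nat) : {mpoly F[n]} :=
  \sum_(la <- partitions k) ((alpha ^+ plen la)^-1 * ((zee la)%:R)^-1) *: pla n la.
Definition qq (n : nat) (la : seq nat) : {mpoly F[n]} := \prod_(a <- la) Qn n a.

Definition eprime (la : seq nat) : F :=
  alpha * (\sum_(i < size la) ((nth 0%N la i) ^ 2)%:R) / 2%:R
  - \sum_(i < size la) (i.+1 * nth 0%N la i)%:R.

(* ---------- moving up operator (0-indexed positions i < j) ---------- *)
Definition moveup (la : seq nat) (i j k : nat) : seq nat :=
  (sort geq [seq x <- set_nth 0 (set_nth 0 la i (nth 0 la i + k)) j
                                 (nth 0 la j - k) | 0 < x])%N.
Definition move_triples (la : seq nat) : seq (nat * nat * nat) :=
  [seq t <- flatten [seq [seq (i, j, k) | j <- iota 0 (size la),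
                                          k <- iota 1 (sumn la)]
                     | i <- iota 0 (size la)]
  | ((t.1.1 < t.1.2) && (t.2 <= nth 0 la t.1.2))%N].
Definition Mstar (la : seq nat) : seq (seq nat) :=
  undup [seq moveup la t.1.1 t.1.2 t.2 | t <- move_triples la].

(* r_{la mu} for mu in M^*(la) (independent of the chosen (i,j,k)) *)
Definition rcoef (la mu : seq nat) : F :=
  if [seq t <- move_triples la | moveup la t.1.1 t.1.2 t.2 == mu] is t :: _ then
    let a := nth 0%N la t.1.1 in let b := nth 0%N la t.1.2 in let k := t.2 in
    (1 + (a == b)%:R)^-1 * (mult a la)%:R * ((mult b la)%:R - (a == b)%:R)
      * ((a + 2 * k)%N%:R - b%:R)
  else 0.

Fixpoint chains (fuel : nat) (cur tgt : seq nat) : seq (seq (seq nat)) :=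
  (if cur == tgt then [:: [:: cur]] else [::]) ++
  (if fuel is f.+1 then
     flatten [seq [seq cur :: c | c <- chains f nu tgt] | nu <- Mstar cur]
   else [::]).

(* each step of a moving up filtration strictly decreases sum_i i*la_i,
   which lies in [0, n(n-1)/2]; hence n*n steps suffice *)
Definition filtrations (mu la : seq nat) : seq (seq (seq nat)) :=
  undup (chains (sumn mu * sumn mu) mu la).

Definition fup (la : seq nat) (d : seq (seq nat)) : F :=
  \prod_(pr <- zip d (behead d)) (rcoef pr.1 pr.2 / (eprime la - eprime pr.1)).
Definition fdown (mu : seq nat) (d : seq (seq nat)) : F :=
  \prod_(pr <- zip d (behead d)) (rcoef pr.1 pr.2 / (eprime mu - eprime pr.2)).

(* Main.v *)
(* Realise the Laplace-Beltrami operator as a second-order differential operator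
   in the power sums, self-adjoint because p_k is adjoint to alpha k d/dp_k.
   Newton's identities show that it sends q_la to
   e'_la q_la + sum_mu r_(la mu) q_mu, the sum running over the moving up of la.
   The q's being dual to the monomial functions, its matrix in the basis of the
   P's is triangular; since the P's are orthogonal it is also symmetric, so the
   Jack functions are eigenvectors with eigenvalues e'_la. Comparing coefficients
   on the m's and on the q's gives the recursions
     (e'_la - e'_mu) v_(la mu) = sum_nu r_(mu nu) v_(la nu),
     (e'_mu - e'_la) C_(mu la) = sum_nu C_(mu nu) r_(nu la),
   and unrolling them along moving up filtrations yields the two formulas. *)

(* The ring keeps only p_1, ..., p_n, every later p_k being 0. Newton's identities survive this at
   every index; what has to be watched is the derivative along an absent p_k, set to 0, which is
   right on Q_a only for a <= n. Dividing by e'_la - e'_mu is legitimate because alpha is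
   transcendental: equal values of e' would force equal values of sum_i i la_i, and this statistic
   strictly drops as la rises in dominance. It is also the measure of the inductions and bounds the
   length of filtrations. Independence and nonzero norms of the P's have to be proved. The pairing
   of q_mu with g is the coefficient of x^mu in g, so the q's and the P's pair by a unitriangular
   matrix, and a combination of q's orthogonal to every P is 0. This principle yields the norms, the
   shape of P in the q's, the eigenvector equation and the recursion for C. That last recursion
   extends filtrations at their end, whereas they are enumerated from their start; a sum evaluated
   in two ways reconciles the two. *)
Require Import Defs.
From HB Require Import structures.
From mathcomp Require Import all_boot all_order all_algebra.
From mathcomp Require Import fraction.
From mathcomp Require Import mpoly.
From mathcomp Require Import zify ring.
Import Order.TTheory GRing.Theory Num.Theory.
Local Open Scope ring_scope.
Set Implicit Arguments.
Unset Strict Implicit.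
Unset Printing Implicit Defensive.

(** * Partitions, dominance order and moving up *)

Section PartitionCombinatorics.
Local Open Scope nat_scope.

Lemma geq_trans : transitive geq.
Proof. by move=> y x z; rewrite /geq /= => ? ?; lia. Qed.

Lemma geq_total : total geq.
Proof. by move=> x y; rewrite /geq /=; lia. Qed.

Lemma geq_anti : antisymmetric geq.
Proof. by move=> x y; rewrite /geq /=; lia. Qed.

Lemma size_le_sumn s : all (fun x => 0 < x) s -> (size s <= sumn s).
Proof. by elim: s => //= x s IHs /andP[x0 /IHs]; lia. Qed.

Lemma mem_le_sumn x s : x \in s -> (x <= sumn s).
Proof.
elim: s => //= y s IHs; rewrite in_cons => /orP[/eqP->|/IHs]; lia.
Qed.

Lemma nth_le_sumn s i : (nth 0 s i <= sumn s).
Proof.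
have [lt_is|] := ltnP i (size s); first exact: mem_le_sumn (mem_nth _ lt_is).
by move=> ?; rewrite nth_default.
Qed.

Lemma filter_pos_id s : all (fun x => 0 < x) s -> [seq x <- s | 0 < x] = s.
Proof. by move/all_filterP. Qed.

Lemma filter_pos_map_nth n s : (size s <= n) ->
  [seq x <- [seq nth 0 s i | i : 'I_n] | 0 < x] = [seq x <- s | 0 < x].
Proof.
move=> size_s; rewrite [image_mem _ _](map_comp (nth 0 s) val) val_enum_ord.
have -> : [seq nth 0 s i | i <- iota 0 n] = s ++ nseq (n - size s) 0.
  apply: (@eq_from_nth _ 0).
    by rewrite size_map size_iota size_cat size_nseq subnKC.
  move=> i; rewrite size_map size_iota => lt_in.
  rewrite (nth_map 0) ?size_iota // nth_iota // add0n nth_cat nth_nseq.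
  by case: ltnP => // ?; rewrite nth_default //; case: ifP.
rewrite filter_cat; have -> : [seq x <- nseq (n - size s) 0 | 0 < x] = [::].
  by elim: (n - size s).
exact: cats0.
Qed.

Lemma mem_partitions n s : (s \in partitions n) = is_partition_of n s.
Proof.
rewrite mem_undup mem_filter andb_idr // => /andP[/andP[_ s_gt0] /eqP sum_s].
have size_s : (size s <= n) by rewrite -sum_s size_le_sumn.
apply/mapP; exists [tuple inord (nth 0 s i) | i < n]; first exact: mem_enum.
rewrite /= -map_comp (eq_map (_ : _ =1 fun i : 'I_n => nth 0 s i)).
  by rewrite filter_pos_map_nth // filter_pos_id.
by move=> i /=; rewrite inordK // ltnS -[X in _ <= X]sum_s; exact: nth_le_sumn.
Qed.

Lemma partitionsP n s :
  reflect [/\ sorted geq s, all (fun x => 0 < x) s & sumn s = n]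
          (s \in partitions n).
Proof.
rewrite mem_partitions; apply: (iffP idP).
  by case/andP=> /andP[? ?] /eqP.
by case=> ? ? <-; rewrite /is_partition_of /is_partition eqxx andbT; apply/andP.
Qed.

Lemma size_partition n s : s \in partitions n -> (size s <= n).
Proof. by case/partitionsP=> _ ? <-; exact: size_le_sumn. Qed.

Lemma eq_partition n s t : s \in partitions n -> t \in partitions n ->
  (forall x, 0 < x -> count_mem x s = count_mem x t) -> s = t.
Proof.
case/partitionsP=> s_sorted s_gt0 _ /partitionsP[t_sorted t_gt0 _] eq_st.
apply: (sorted_eq geq_trans geq_anti) => //.
apply/permP=> p; rewrite -(filter_pos_id s_gt0) -(filter_pos_id t_gt0).
move: p; apply/permP/allP => x _; apply/eqP.
rewrite !count_filter; case: (posnP x) => [->|x0].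
  by rewrite !(eq_count (a2 := pred0)) ?count_pred0 //; move=> y /=; case: eqP => // ->.
rewrite !(eq_count (a1 := predI _ _) (a2 := pred1 x)); first exact: eq_st.
  by move=> y /=; case: eqP => // ->.
by move=> y /=; case: eqP => // ->.
Qed.

Lemma sumn_sort_pos s : sumn (sort geq [seq x <- s | 0 < x]) = sumn s.
Proof.
rewrite !sumnE (perm_big _ (permEl (perm_sort _ _))) /= big_filter.
rewrite [RHS](bigID (fun x => 0 < x)) /= [X in _ = _ + X]big1 ?addn0 //.
by move=> x; lia.
Qed.

Definition psums k s := sumn (take k s).

(** Stated for arbitrary lists, so that the unsorted lists with zeros met in the middle of a move
    can be compared too. *)
Definition dominated s t := forall k, (psums k s <= psums k t).

Lemma dominated_trans t s u : dominated s t -> dominated t u -> dominated s u.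
Proof. by move=> st tu k; apply: leq_trans (st k) (tu k). Qed.

Lemma dominated_cons x s t : dominated s t -> dominated (x :: s) (x :: t).
Proof. by move=> st [|k] //; rewrite /psums /= leq_add2l; apply: st. Qed.

(** Insertion sort is a means to analyse [sort]: an insertion is a run of adjacent swaps, each
    carrying a larger entry forward, which can only raise prefix sums. *)
Fixpoint insert a s :=
  if s is b :: s' then if (b <= a) then a :: s else b :: insert a s' else [:: a].

Lemma dominated_insert a s : dominated (a :: s) (insert a s).
Proof.
elim: s => [|b s IHs] //=; case: leqP => [_ k|lt_ab] //.
apply: (dominated_trans (t := b :: a :: s)); last exact: dominated_cons.
by move=> [|[|k]] //; rewrite /psums /= ?addn0; lia.
Qed.

Lemma perm_insert a s : perm_eq (insert a s) (a :: s).
Proof.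
elim: s => [|b s IHs] //=; case: ifP => // _.
rewrite (perm_trans (y := b :: a :: s)) ?perm_cons //.
by apply/permP=> p /=; lia.
Qed.

Lemma sorted_insert a s : sorted geq s -> sorted geq (insert a s).
Proof.
elim: s => [|b s IHs] //= b_s; case: (leqP b a) => [le_ba|lt_ab] /=.
  by rewrite /geq /= le_ba.
have := IHs (path_sorted b_s); move: b_s {IHs}.
case: s => [|c s] /=; first by rewrite /geq /=; lia.
by case: (leqP c a) => /= _; rewrite /geq /=; lia.
Qed.

Definition insort := foldr insert [::].

Lemma insortE s : insort s = sort geq s.
Proof.
apply: (sorted_eq geq_trans geq_anti); rewrite ?sort_sorted //; last 1 first.
- rewrite perm_sym perm_sort perm_sym.
  elim: s => //= x s IHs; apply: perm_trans (perm_insert _ _) _.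
  by rewrite perm_cons.
- by elim: s => //= x s; apply: sorted_insert.
- exact: geq_total.
Qed.

Lemma dominated_sort s : dominated s (sort geq s).
Proof.
rewrite -insortE; elim: s => //= x s IHs.
by apply: dominated_trans (dominated_cons x IHs) (dominated_insert _ _).
Qed.

Lemma psumsS_le k s : (psums k s <= psums k.+1 s).
Proof. by elim: s k => // x s IHs [|k] //; rewrite /psums /= leq_add2l; apply: IHs. Qed.

Lemma dominated_filter s : dominated s [seq x <- s | 0 < x].
Proof.
elim: s => // x s IHs [|k] //=; case: (posnP x) => [->|x0] /=.
  by rewrite /psums /= add0n; apply: leq_trans (IHs k) (psumsS_le _ _).
by rewrite /psums /= leq_add2l; apply: IHs.
Qed.

Lemma psums_set_nth k s i x : (i < size s) ->
  (psums k (set_nth 0 s i x) + (i < k) * nth 0 s i = psums k s + (i < k) * x).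
Proof.
rewrite /psums; elim: s i k => // y s IHs [|i] [|k] //=; first by lia.
by move=> lt_is; have := IHs i k lt_is; rewrite ltnS; lia.
Qed.

Lemma psums_oversize k s : (size s <= k) -> psums k s = sumn s.
Proof. by move=> le_sk; rewrite /psums take_oversize. Qed.

Definition raw_move s i j k :=
  set_nth 0 (set_nth 0 s i (nth 0 s i + k)) j (nth 0 s j - k).

Section Move.

Variables (s : seq nat) (i j k : nat).
Hypotheses (lt_ij : (i < j)) (lt_js : (j < size s)).
Hypotheses (k_gt0 : (0 < k)) (le_kj : (k <= nth 0 s j)).

Lemma size_raw_move : size (raw_move s i j k) = size s.
Proof. by rewrite /raw_move !size_set_nth; lia. Qed.

(** The amount k is gained at i and lost at j, so exactly the prefixes containing i but not j grow.
    The additive form avoids truncated subtraction. *)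
Lemma psums_raw_move h :
  (psums h (raw_move s i j k) + (j < h) * k = psums h s + (i < h) * k).
Proof.
have lt_is := ltn_trans lt_ij lt_js.
have lt_js' : (j < size (set_nth 0 s i (nth 0 s i + k))).
  by rewrite size_set_nth; lia.
have := psums_set_nth h (nth 0 s i + k) lt_is.
have := psums_set_nth h (nth 0 s j - k) lt_js'.
rewrite nth_set_nth /= (gtn_eqF lt_ij) /raw_move; nia.
Qed.

Lemma dominated_moveup : dominated s (moveup s i j k).
Proof.
apply: (dominated_trans (t := raw_move s i j k)) => [h|].
  by have := psums_raw_move h; nia.
by apply: dominated_trans (dominated_filter _) (dominated_sort _).
Qed.

Lemma psums_moveup : (psums i.+1 s < psums i.+1 (moveup s i j k)).
Proof.
have := dominated_trans (@dominated_filter _) (@dominated_sort _) i.+1.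
move/(_ (raw_move s i j k)); apply: leq_trans.
by have := psums_raw_move i.+1; nia.
Qed.

(** The value 0 is excluded because a part emptied by the move is dropped from the list. *)
Lemma count_moveup x : (0 < x) ->
  (count_mem x (moveup s i j k) + (nth 0 s i == x) + (nth 0 s j == x)
   = count_mem x s + (nth 0 s i + k == x) + (nth 0 s j - k == x)).
Proof.
move=> x0; have lt_is := ltn_trans lt_ij lt_js.
have count_set t h y : (h < size t) ->
    (count_mem x (set_nth 0 t h y) + (nth 0 t h == x)
     = count_mem x t + (y == x)).
  elim: t h => // z t IHt [|h] /=; first by lia.
  by rewrite ltnS => /IHt eq_t; rewrite -!addnA eq_t.
have lt_js' : (j < size (set_nth 0 s i (nth 0 s i + k))).
  by rewrite size_set_nth; lia.
have := count_set _ _ (nth 0 s i + k) lt_is.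
have := count_set _ _ (nth 0 s j - k) lt_js'.
rewrite nth_set_nth /= (gtn_eqF lt_ij) /moveup count_sort count_filter.
rewrite (eq_count (a1 := predI _ _) (a2 := pred1 x)); last first.
  by move=> y /=; case: eqP => // ->.
by move=> count_j count_i; rewrite addnAC count_j addnAC count_i.
Qed.

Lemma sumn_moveup : sumn (moveup s i j k) = sumn s.
Proof.
rewrite sumn_sort_pos -/(raw_move s i j k).
have := psums_raw_move (size s).
by rewrite !psums_oversize ?size_raw_move //; nia.
Qed.

Lemma moveup_partition n : s \in partitions n -> moveup s i j k \in partitions n.
Proof.
case/partitionsP=> _ _ <-; apply/partitionsP; split.
- by apply: sort_sorted; exact: geq_total.
- by rewrite all_sort filter_all.
- exact: sumn_moveup.
Qed.

End Move.

End PartitionCombinatorics.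

(** * Counting moves, and the statistic sum_i i s_i *)

Section Triples.
Local Open Scope nat_scope.

(** The range [iota 1 (sumn s)] for the amount moved loses nothing, since no part exceeds the
    total. *)
Lemma mem_move_triples s t : (t \in move_triples s) =
  [&& t.1.1 < t.1.2, t.1.2 < size s, 0 < t.2 & t.2 <= nth 0 s t.1.2].
Proof.
case: t => [[i j] k] /=; rewrite mem_filter /=.
apply/andP/and4P=> [[/andP[lt_ij le_k]]|[lt_ij lt_js k0 le_k]].
  case/flatten_mapP => i' _ /allpairsP[[j' k'] /= [mem_j mem_k [_ eq_j eq_k]]].
  by move: mem_j mem_k; rewrite -eq_j -eq_k !mem_iota => ? ?; split=> //; lia.
rewrite lt_ij le_k; split=> //; apply/flatten_mapP; exists i.
  by by rewrite mem_iota; lia.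
apply/allpairsP; exists (j, k); rewrite /= !mem_iota; split=> //=.
by have := nth_le_sumn s j; lia.
Qed.

Lemma sum_move_triples (V : nmodType) (G : nat -> nat -> nat -> V) s :
  (\sum_(t <- move_triples s) G t.1.1 t.1.2 t.2 =
   \sum_(i < size s) \sum_(j < size s | (i < j)%N) \sum_(k < nth 0%N s j) G i j k.+1)%R.
Proof.
have sum_iota m (H : nat -> V) : (\sum_(i <- iota 0 m) H i = \sum_(i < m) H i)%R.
  by rewrite -(big_mkord xpredT) /index_iota subn0.
rewrite big_filter big_mkcond big_flatten big_map sum_iota.
apply: eq_bigr => i _; rewrite big_allpairs_dep sum_iota [RHS]big_mkcond.
apply: eq_bigr => j _ /=; case: ifP => _ /=; last by rewrite big1.
rewrite -(addn0 1) iotaDl big_map sum_iota -big_mkcond /=.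
by rewrite (big_ord_widen _ (fun k => G i j k.+1) (nth_le_sumn s j)).
Qed.

(** Number of pairs of positions i < j holding the values a and b; it is the multiplicity factor of
    [rcoef]. *)
Fixpoint pairs_eq (a b : nat) (s : seq nat) :=
  if s is x :: s' then (x == a) * count_mem b s' + pairs_eq a b s' else 0.

Lemma pairs_eqE a b s :
  \sum_(i < size s) \sum_(j < size s | i < j) (nth 0 s i == a) * (nth 0 s j == b)
  = pairs_eq a b s.
Proof.
elim: s => [|x s IHs]; first by rewrite big_ord0.
rewrite big_ord_recl /= -IHs; congr (_ + _).
  rewrite big_mkcond big_ord_recl /= add0n.
  rewrite -big_distrr /=; congr (_ * _).
  by rewrite -sum1_count (big_nth 0) big_mkord [RHS]big_mkcond /=; apply: eq_bigr => j _; case: eqP.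
apply: eq_bigr => i _; rewrite big_mkcond big_ord_recl /= add0n [RHS]big_mkcond.
by apply: eq_bigr.
Qed.

Lemma pairs_eq_neq a b s : sorted geq s -> b < a ->
  pairs_eq a b s = count_mem a s * count_mem b s.
Proof.
move=> + lt_ba; elim: s => //= x s IHs x_s.
rewrite (IHs (path_sorted x_s)); case: (x =P a) => [->|_] /=.
  by rewrite (gtn_eqF lt_ba) /=; nia.
case: (x =P b) => [xb|_] //=; rewrite mul0n !add0n.
suff -> : count_mem a s = 0 by [].
move: x_s; rewrite (path_sortedE geq_trans) xb => /andP[/allP ge_b _].
apply/count_memPn/negP => /ge_b; rewrite /geq /=; lia.
Qed.

(** Equal values form unordered pairs, whence the 1/2 that (1 + delta)^-1 produces in [rcoef]. *)
Lemma pairs_eq_eq a s :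
  pairs_eq a a s * 2 = count_mem a s * (count_mem a s).-1.
Proof.
elim: s => //= x s; case: (x =P a) => _ /=; last by rewrite mul0n !add0n.
by case: (count_mem a s) => [|c]; nia.
Qed.

Lemma cancel_counts c m x y z w x' y' z' w' :
  c + x + y = m + z + w -> c + x' + y' = m + z' + w' ->
  z + w + x' + y' = z' + w' + x + y.
Proof. by lia. Qed.

(** The hypothesis is an equality of multisets of positive parts. If the raised parts a + k and a' +
    k' differed, the larger would occur on one side only. Once they cancel, the larger of a and a'
    is isolated likewise, and b is recovered because k > 0 separates it from b - k. *)
Lemma move_sizes a b k a' b' k' : b <= a -> b' <= a' -> k <= b -> k' <= b' ->
  0 < k -> 0 < k' ->
  (forall x, 0 < x ->
     (a + k == x) + (b - k == x) + (a' == x) + (b' == x)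
     = (a' + k' == x) + (b' - k' == x) + (a == x) + (b == x)) ->
  [/\ a = a', b = b' & k = k'].
Proof.
move=> ba ba' kb kb' k0 k0' eq_count.
have eq_ak : a + k = a' + k'.
  have /eqP-> // : a + k == a' + k'.
  rewrite eqn_leq; apply/andP; split; rewrite leqNgt; apply/negP => lt_ak.
    have := eq_count (a + k) ltac:(lia); rewrite eqxx.
    have -> : (a' + k' == a + k) = false by lia.
    have -> : (b' - k' == a + k) = false by lia.
    have -> : (a == a + k) = false by lia.
    by have -> : (b == a + k) = false by lia.
  have := eq_count (a' + k') ltac:(lia); rewrite eqxx.
  have -> : (a + k == a' + k') = false by lia.
  have -> : (b - k == a' + k') = false by lia.
  have -> : (a' == a' + k') = false by lia.
  by have -> : (b' == a' + k') = false by lia.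
have eq_a : a = a'.
  have /eqP-> // : a == a'.
  rewrite eqn_leq; apply/andP; split; rewrite leqNgt; apply/negP => lt_a.
    have := eq_count a ltac:(lia); rewrite eqxx.
    have -> : (a + k == a) = false by lia.
    have -> : (b - k == a) = false by lia.
    have -> : (a' == a) = false by lia.
    have -> : (b' == a) = false by lia.
    by rewrite !addn0 -addnA add1n addnS.
  have := eq_count a' ltac:(lia); rewrite eqxx.
  have -> : (a' + k' == a') = false by lia.
  have -> : (b' - k' == a') = false by lia.
  have -> : (a == a') = false by lia.
  have -> : (b == a') = false by lia.
  by rewrite -addnA add1n addnS.
have eq_k : k = k' by lia.
split=> //; subst a' k'.
have := eq_count b ltac:(lia); rewrite eqxx.
have -> : (b - k == b) = false by lia.
have -> : (a + k == b) = false by lia.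
case: (b' =P b) => // _; move: (_ == _ :> nat) (_ == _ :> nat); lia.
Qed.

(* This is why [rcoef] does not depend on the triple it picks. *)
Lemma moveup_inj n s i j k i' j' k' : s \in partitions n ->
  i < j -> j < size s -> 0 < k -> k <= nth 0 s j ->
  i' < j' -> j' < size s -> 0 < k' -> k' <= nth 0 s j' ->
  (moveup s i j k == moveup s i' j' k') =
  [&& nth 0 s i == nth 0 s i', nth 0 s j == nth 0 s j' & k == k'].
Proof.
move=> s_part ij js k0 kj ij' js' k0' kj'.
have s_sorted : sorted geq s by case/partitionsP: s_part.
have nth_ge h h' : h < h' -> h' < size s -> nth 0 s h' <= nth 0 s h.
  move=> lt_h lt_h'.
  exact: (sorted_ltn_nth geq_trans 0 s_sorted h h' (ltn_trans lt_h lt_h') lt_h' lt_h).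
have le_ji := nth_ge _ _ ij js; have le_ji' := nth_ge _ _ ij' js'.
apply/eqP/and3P => [eq_up|[/eqP eq_i /eqP eq_j /eqP eq_k]].
  have eq_count x (x0 : 0 < x) :
      (nth 0 s i + k == x) + (nth 0 s j - k == x) + (nth 0 s i' == x) + (nth 0 s j' == x)
      = (nth 0 s i' + k' == x) + (nth 0 s j' - k' == x) + (nth 0 s i == x) + (nth 0 s j == x).
    have := count_moveup ij js k0 kj x0; have := count_moveup ij' js' k0' kj' x0.
    by rewrite eq_up => count' count; exact: cancel_counts count count'.
  by have [-> -> ->] := move_sizes le_ji le_ji' kj kj' k0 k0' eq_count.
apply: (eq_partition (moveup_partition ij js k0 kj s_part)
                     (moveup_partition ij' js' k0' kj' s_part)) => x x0.
have := count_moveup ij js k0 kj x0; have := count_moveup ij' js' k0' kj' x0.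
by rewrite eq_i eq_j eq_k => <- /addIn /addIn.
Qed.

(** The sum subtracted in e'. In Macdonald's notation it is n(s) + |s|. *)
Definition nstat s := \sum_(i < size s) i.+1 * nth 0 s i.

(** Entry number i, counted from 1, lies in the N - i prefixes of length i, ..., N - 1. So [nstat]
    is a constant minus a sum of prefix sums, which is why it reverses dominance. *)
Lemma nstat_psums s N : size s <= N ->
  \sum_(h < N) psums h s + nstat s = N * sumn s.
Proof.
rewrite /nstat; elim: s N => [|x s IHs] N /=.
  by rewrite big_ord0 muln0 big1 // => h _; rewrite /psums; case: (val h).
case: N => // N; rewrite ltnS => /IHs eq_N.
rewrite big_ord_recl big_ord_recl /= {1}/psums /= add0n mul1n.
rewrite (eq_bigr (fun h : 'I_N => x + psums h s)) // big_split /=.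
rewrite sum_nat_const card_ord.
rewrite (eq_bigr (fun i : 'I_(size s) => nth 0 s i + i.+1 * nth 0 s i)) //.
rewrite big_split /=; have -> : \sum_(i < size s) nth 0 s i = sumn s.
  by rewrite sumnE (big_nth 0) big_mkord.
have expand A B c : A + B = N * c -> N * x + A + (x + (c + B)) = N.+1 * (x + c).
  by nia.
exact: expand.
Qed.

Lemma nstat_le s : nstat s <= size s * sumn s.
Proof. by rewrite -(nstat_psums (leqnn _)) leq_addl. Qed.

Lemma nstat_lt s t h : sumn s = sumn t -> dominated s t ->
  psums h s < psums h t -> nstat t < nstat s.
Proof.
(* N exceeds both sizes and h, so that the strict prefix h is among those summed. *)
move=> eq_st le_st lt_h; pose N := (size s + size t + h).+1.
have := @nstat_psums s N ltac:(rewrite /N; lia).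
have := @nstat_psums t N ltac:(rewrite /N; lia).
have lt_hN : h < N by rewrite /N; lia.
have : \sum_(h < N) psums h s < \sum_(h < N) psums h t.
  rewrite (bigD1 (Ordinal lt_hN)) //= [X in _ < X](bigD1 (Ordinal lt_hN)) //=.
  by rewrite -addSn leq_add // leq_sum.
by rewrite eq_st; lia.
Qed.

Lemma dom_leP s t : reflect (sumn s = sumn t /\ dominated s t) (dom_le s t).
Proof.
apply: (iffP andP) => [[/eqP eq_st /allP le_st]|[-> le_st]]; split=> //.
  move=> k; have [lt_k|le_k] := ltnP k (size s + size t).+1.
    by apply: (le_st k); rewrite mem_iota.
  by rewrite !psums_oversize ?eq_st //; lia.
by apply/allP => k _; apply: le_st.
Qed.

Lemma psums_inj s t : all (fun x => 0 < x) s -> all (fun x => 0 < x) t ->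
  (forall k, psums k s = psums k t) -> s = t.
Proof.
elim: s t => [|x s IHs] [|y t] //= => [_ /andP[y0 _]|/andP[x0 _] _|].
- by move/(_ 1); rewrite /psums /= take0 /=; lia.
- by move/(_ 1); rewrite /psums /= take0 /=; lia.
case/andP=> x0 s0 /andP[y0 t0] eq_st.
have := eq_st 1; rewrite /psums /= !take0 /= !addn0 => eq_xy.
rewrite eq_xy (IHs t) // => k; have := eq_st k.+1; rewrite /psums /=; lia.
Qed.

Lemma dom_le_refl s : dom_le s s.
Proof. by apply/dom_leP; split=> // k. Qed.

Lemma dom_le_trans s t u : dom_le s t -> dom_le t u -> dom_le s u.
Proof.
case/dom_leP=> e1 d1 /dom_leP[e2 d2]; apply/dom_leP; split; first by rewrite e1.
exact: dominated_trans d1 d2.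
Qed.

Lemma dom_lt_nstat n s t : s \in partitions n -> t \in partitions n ->
  dom_lt s t -> nstat t < nstat s.
Proof.
case/partitionsP=> _ s0 _ /partitionsP[_ t0 _] /andP[/dom_leP[eq_st le_st] /eqP neq_st].
rewrite ltnNge; apply/negP => le_nstat; case: neq_st; apply: psums_inj => // k.
apply/eqP; rewrite eqn_leq le_st leqNgt; apply/negP => /(nstat_lt eq_st le_st); lia.
Qed.

Lemma dom_lt_moveup s i j k : i < j -> j < size s -> 0 < k -> k <= nth 0 s j ->
  dom_lt s (moveup s i j k).
Proof.
move=> ij js k0 kj; apply/andP; split.
  by apply/dom_leP; rewrite sumn_moveup //; split=> //; exact: dominated_moveup.
by apply/eqP => eq_s; have := psums_moveup ij js k0 kj; rewrite -eq_s ltnn.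
Qed.

Lemma mem_Mstar n s t : s \in partitions n -> t \in Mstar s ->
  t \in partitions n /\ dom_lt s t.
Proof.
move=> s_part; rewrite mem_undup => /mapP[[[i j] k]].
rewrite mem_move_triples => /and4P[/= ij js k0 kj] ->; split.
  exact: moveup_partition.
exact: dom_lt_moveup.
Qed.

End Triples.

(** * Eigenvalue gaps and the coefficients r_(la mu) *)

Lemma natF_neq0 k : (0 < k)%N -> k%:R != 0 :> F.
Proof.
move=> k0; rewrite -(rmorph_nat (@FracField.tofrac {poly rat})) tofrac_eq0.
by rewrite -polyC_natr polyC_eq0 pnatr_eq0 -lt0n.
Qed.

Lemma alpha_neq0 : alpha != 0.
Proof. by rewrite tofrac_eq0 polyX_eq0. Qed.

(** Clearing the denominator 2 leaves an identity between polynomials in the indeterminate alpha,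
    whose constant terms are -2 times the two [nstat]. *)
Lemma eprime_inj_nstat s t : eprime s = eprime t -> nstat s = nstat t.
Proof.
rewrite /eprime -!natr_sum -/(nstat s) -/(nstat t).
move: (nstat s) (nstat t) (\sum_(i < _) _)%N (\sum_(i < _) _)%N => x y d c eq_e.
have {eq_e} : alpha * c%:R - 2%:R * x%:R = alpha * d%:R - 2%:R * y%:R.
  have two0 : 2%:R != 0 :> F by exact: natF_neq0.
  have := congr1 (fun z => 2%:R * z) eq_e.
  by rewrite !mulrBr !(mulrC 2%:R (_ / 2%:R)) !divfK.
rewrite -!(rmorph_nat (@FracField.tofrac {poly rat})) -!rmorphM -!rmorphB /=.
move/eqP; rewrite tofrac_eq => /eqP /(congr1 (fun p : {poly rat} => p`_0)).
rewrite !coefB !coefXM /= !sub0r -!polyC_natr !coefC /= => /oppr_inj /eqP.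
by rewrite eqr_nat => /eqP; lia.
Qed.

Lemma dom_lt_eprime n s t : s \in partitions n -> t \in partitions n ->
  dom_lt s t -> eprime t - eprime s != 0.
Proof.
move=> s_part t_part /(dom_lt_nstat s_part t_part) lt_st.
by apply/negP; rewrite subr_eq0 => /eqP/eprime_inj_nstat; lia.
Qed.

(** The defining product is a count in disguise: by [moveup_inj] all triples reaching t share the
    parts a, b and the amount k, hence the summand, and there are [pairs_eq a b s] of them. The sum
    is the form in which the Laplace-Beltrami operator produces r. *)
Lemma rcoefE n s t : s \in partitions n ->
  rcoef s t =
  \sum_(u <- move_triples s | moveup s u.1.1 u.1.2 u.2 == t)
     ((nth 0%N s u.1.1 + 2 * u.2)%N%:R - (nth 0%N s u.1.2)%:R).
Proof.
move=> s_part; rewrite /rcoef -big_filter.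
set L := [seq _ <- _ | _].
case def_L: L => [|u L']; first by rewrite big_nil.
have : u \in L by rewrite def_L mem_head.
rewrite mem_filter mem_move_triples => /andP[/eqP up_u /and4P[ij js k0 kj]].
set a := nth 0%N s u.1.1; set b := nth 0%N s u.1.2.
have up_eq v : v \in move_triples s -> (moveup s v.1.1 v.1.2 v.2 == t) =
    [&& nth 0%N s v.1.1 == a, nth 0%N s v.1.2 == b & v.2 == u.2].
  rewrite mem_move_triples -up_u => /and4P[ij' js' k0' kj'].
  exact: (moveup_inj s_part).
have -> : \sum_(v <- u :: L') ((nth 0%N s v.1.1 + 2 * v.2)%N%:R - (nth 0%N s v.1.2)%:R)
    = \sum_(v <- u :: L') ((a + 2 * u.2)%N%:R - b%:R) :> F.
  rewrite -def_L; apply: eq_big_seq => v; rewrite mem_filter => /andP[up_v v_s].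
  by move: up_v; rewrite up_eq // => /and3P[/eqP-> /eqP-> /eqP->].
rewrite big_const_seq count_predT iter_addr_0 -[RHS]mulr_natl; congr (_ * _).
have -> : size (u :: L') = pairs_eq a b s.
  rewrite -def_L size_filter -sum1_count big_mkcond /=.
  rewrite (eq_big_seq (fun v => ((nth 0%N s v.1.1 == a) * (nth 0%N s v.1.2 == b) *
                                  (v.2 == u.2))%N)); last first.
    by move=> v /up_eq ->; do !case: (_ == _).
  rewrite (sum_move_triples (fun i j k => ((nth 0%N s i == a) * (nth 0%N s j == b) *
                                  (k == u.2))%N)).
  rewrite -pairs_eqE; apply: eq_bigr => i _; apply: eq_bigr => j _.
  rewrite -big_distrr /=; case: (nth 0%N s j =P b) => [eq_b|]; last by rewrite muln0.
  (* Only one amount contributes for given positions; its index is one less, because the summation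
     variable starts at 0. *)
  have lt_u : (u.2.-1 < nth 0%N s j)%N by rewrite prednK // eq_b.
  rewrite (bigD1 (Ordinal lt_u)) //= prednK // eqxx big1; first exact: muln1.
  move=> k.
  by rewrite -val_eqE /=; case: (val k) => [|?]; case: (u.2) k0 => //= ? _; rewrite eqSS => /negPf->.
have [s_sorted _ _] := partitionsP _ _ s_part.
have := sorted_ltn_nth geq_trans 0%N s_sorted u.1.1 u.1.2; rewrite !inE /geq /=.
move/(_ (ltn_trans ij js) js ij); rewrite -/a -/b leq_eqVlt => /orP[/eqP eq_ab|lt_ba].
  rewrite eq_ab eqxx /= -/(mult a s).
  have := pairs_eq_eq a s; rewrite -/(mult a s).
  have mult_gt0 : (0 < mult a s)%N.
    by rewrite -has_count has_pred1 mem_nth // (ltn_trans ij).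
  move/(congr1 (fun k => k%:R : F)); rewrite !natrM -subn1 natrB //.
  have two0 : 2%:R != 0 :> F by exact: natF_neq0.
  move=> eq_pairs; apply: (mulIf two0); rewrite eq_pairs.
  by field.
rewrite (gtn_eqF lt_ba) /= pairs_eq_neq // natrM subr0 addr0 invr1 mul1r.
by [].
Qed.

Lemma rcoef_notin s t : t \notin Mstar s -> rcoef s t = 0.
Proof.
rewrite mem_undup /rcoef => t_notin.
case def_L: [seq _ <- _ | _] => [|u L'] //; case/negP: t_notin.
have : u \in u :: L' by exact: mem_head.
by rewrite -def_L mem_filter => /andP[/eqP<- u_s]; apply: (map_f _ u_s).
Qed.

(** * Scalar product and complete functions *)
Section ScalarProduct.
Variable n : nat.
Implicit Types (f g h : {mpoly F[n]}) (m : 'X_{1..n}).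

Definition wt m : F := alpha ^+ mdeg m * (zmon m)%:R.

Lemma zmon_gt0 m : (0 < zmon m)%N.
Proof. by rewrite prodn_gt0 // => i; rewrite muln_gt0 expn_gt0 fact_gt0. Qed.

Lemma wt_neq0 m : wt m != 0.
Proof.
rewrite /wt mulf_neq0 //; last exact: natF_neq0 (zmon_gt0 m).
exact: expf_neq0 alpha_neq0.
Qed.

(** This ratio of norms is what makes multiplication by p_(i+1) adjoint to [dpart i]. *)
Lemma wtDU m i : wt (m + U_(i))%MM = wt m * (alpha * i.+1%:R) * (m i).+1%:R.
Proof.
rewrite /wt mdegD mdeg1 addn1 exprSr.
have -> : zmon (m + U_(i))%MM = (zmon m * (i.+1 * (m i).+1))%N.
  rewrite /zmon (bigD1 i) //= [in RHS](bigD1 i) //= mnmDE mnm1E eqxx addn1.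
  rewrite expnSr factS [X in (_ * X)%N = _](eq_bigr (fun j : 'I_n => j.+1 ^ m j * (m j)`!)%N).
    by move: (\prod_(_ < n | _) _)%N (_ ^ _)%N (_ `!)%N => A B C; nia.
  by move=> j neq_ji; rewrite mnmDE mnm1E eq_sym (negPf neq_ji) addn0.
by rewrite !natrM; ring.
Qed.

Lemma pweightD m m' : pweight (m + m')%MM = (pweight m + pweight m')%N.
Proof.
by rewrite /pweight -big_split; apply: eq_bigr => i _; rewrite mnmDE mulnDr.
Qed.

Lemma pweightU (i : 'I_n) : pweight U_(i)%MM = i.+1.
Proof.
rewrite /pweight (bigD1 i) //= mnm1E eqxx muln1 big1 ?addn0 // => j neq_ji.
by rewrite mnm1E eq_sym (negPf neq_ji) muln0.
Qed.

Lemma mdeg_le_pweight m : (mdeg m <= pweight m)%N.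
Proof. by rewrite mdegE leq_sum // => i _; rewrite mulSn leq_addr. Qed.

(** [scal] runs over the support of its first argument; a common larger index set makes its symmetry
    visible. *)
Lemma scal_supp (r : seq 'X_{1..n}) f g : uniq r -> {subset msupp f <= r} ->
  scal f g = \sum_(m <- r) f@_m * g@_m * wt m.
Proof.
move=> r_uniq sub_r; rewrite [RHS](bigID (mem (msupp f))) /= addrC big1 ?add0r.
  rewrite -[RHS]big_filter; apply: perm_big; apply: uniq_perm.
  - exact: msupp_uniq.
  - exact: filter_uniq.
  by move=> m; rewrite mem_filter andb_idr // => /sub_r.
by move=> m /memN_msupp_eq0 ->; rewrite !mul0r.
Qed.

Lemma scalC f g : scal f g = scal g f.
Proof.
pose r := undup (msupp f ++ msupp g).
rewrite (@scal_supp r f g) ?(@scal_supp r g f) ?undup_uniq //.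
- by apply: eq_bigr => m _; rewrite (mulrC f@_m).
- by move=> m m_g; rewrite mem_undup mem_cat m_g orbT.
- by move=> m m_f; rewrite mem_undup mem_cat m_f.
Qed.

Lemma scalDr f g h : scal f (g + h) = scal f g + scal f h.
Proof.
by rewrite -big_split; apply: eq_bigr => m _ /=; rewrite mcoeffD mulrDr mulrDl.
Qed.

Lemma scalZr a f g : scal f (a *: g) = a * scal f g.
Proof.
by rewrite big_distrr; apply: eq_bigr => m _ /=; rewrite mcoeffZ; ring.
Qed.

Lemma scal0r f : scal f 0 = 0.
Proof. by rewrite -(scale0r 0) scalZr mul0r. Qed.

Lemma scal_sumr (I : Type) (r : seq I) (p : pred I) f (G : I -> {mpoly F[n]}) :
  scal f (\sum_(i <- r | p i) G i) = \sum_(i <- r | p i) scal f (G i).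
Proof. by apply: (big_morph (scal f) (scalDr f) (scal0r f)). Qed.

Lemma scalBr f g h : scal f (g - h) = scal f g - scal f h.
Proof. by rewrite scalDr -scaleN1r scalZr mulN1r. Qed.

Lemma scalDl f g h : scal (f + g) h = scal f h + scal g h.
Proof. by rewrite scalC scalDr !(scalC h). Qed.

Lemma scalBl f g h : scal (f - g) h = scal f h - scal g h.
Proof. by rewrite scalC scalBr !(scalC h). Qed.

Lemma scalZl a f g : scal (a *: f) g = a * scal f g.
Proof. by rewrite scalC scalZr scalC. Qed.

Lemma scal_suml (I : Type) (r : seq I) (p : pred I) f (G : I -> {mpoly F[n]}) :
  scal (\sum_(i <- r | p i) G i) f = \sum_(i <- r | p i) scal (G i) f.
Proof. by rewrite scalC scal_sumr; apply: eq_bigr => i _; rewrite scalC. Qed.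

Lemma scalXl m g : scal 'X_[m] g = g@_m * wt m.
Proof. by rewrite /scal msuppX big_seq1 mcoeffX eqxx mul1r. Qed.

Definition dpart (i : 'I_n) f : {mpoly F[n]} := (alpha * i.+1%:R) *: f^`M(i).

Lemma dpartD i : {morph dpart i : f g / f + g}.
Proof. by move=> f g; rewrite /dpart mderivD scalerDr. Qed.

Lemma dpartM i f g : dpart i (f * g) = dpart i f * g + f * dpart i g.
Proof. by rewrite /dpart mderivM scalerDr scalerAl scalerAr. Qed.

Lemma dpart1 i : dpart i 1 = 0.
Proof. by rewrite /dpart -mpolyC1 mderivC scaler0. Qed.

Lemma mpoly_span (K : {mpoly F[n]} -> Prop) :
  (forall f g, K f -> K g -> K (f + g)) -> (forall a f, K f -> K (a *: f)) ->
  K 0 -> (forall m, K 'X_[m]) -> forall f, K f.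
Proof.
move=> KD KZ K0 KX f; rewrite [f]mpolyE.
by elim/big_ind: _ => // m _; apply: KZ.
Qed.

Lemma scal_mulX i f g : scal ('X_i * f) g = scal f (dpart i g).
Proof.
elim/mpoly_span: f => [f f' IH IH'|a f IH||m].
- by rewrite mulrDr !scalDl IH IH'.
- by rewrite -scalerAr !scalZl IH.
- by rewrite mulr0 !(scalC 0) !scal0r.
rewrite -mpolyXD addmC !scalXl wtDU /dpart mcoeffZ mcoeff_deriv.
by rewrite -mulr_natr; ring.
Qed.

Lemma scal_dpart i f g : scal (dpart i f) g = scal f ('X_i * g).
Proof. by rewrite scalC -scal_mulX scalC. Qed.

End ScalarProduct.

(* This is q_(k - j), with the convention that q vanishes on negative integers. *)
Definition qsub (A : zmodType) (q : nat -> A) k j : A :=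
  if (j <= k)%N then q (k - j)%N else 0.

(** * The functions Q_k in the power sums *)

Section CompleteFunctions.
Variable n : nat.
Implicit Types (f g h : {mpoly F[n]}) (m : 'X_{1..n}).

Definition cmon (s : seq nat) : 'X_{1..n} := [multinom mult i.+1 s | i < n].

Lemma cmon_cons (i : 'I_n) s : cmon (i.+1 :: s) = (U_(i) + cmon s)%MM.
Proof. by apply/mnmP => j; rewrite mnmDE mnm1E !mnmE /mult /= eqSS. Qed.

Lemma pla_cons a s : pla n (a :: s) = pvar n a * pla n s.
Proof. by rewrite /pla big_cons. Qed.

Lemma pvarS (i : 'I_n) : pvar n i.+1 = 'X_i.
Proof. by rewrite /pvar /= valK. Qed.

Lemma pvar_big a : (n < a)%N -> pvar n a = 0.
Proof. by case: a => // a lt_na; rewrite /pvar insubN // -leqNgt. Qed.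

(** A part above n has [pvar] equal to 0. The part 0 is excluded because [pvar n 0] coincides with
    [pvar n 1], the predecessor of 0 being 0. *)
Definition small (s : seq nat) := all (fun a => 0 < a <= n)%N s.

Lemma small_ind (K : seq nat -> Prop) :
  K [::] -> (forall (i : 'I_n) s, small s -> K s -> K (i.+1 :: s)) ->
  forall s, small s -> K s.
Proof.
move=> K0 KS; elim=> //= -[|a] s IHs //= /andP[lt_an s_small].
exact: (KS (Ordinal lt_an)) (IHs s_small).
Qed.

Lemma small_cmon s : small s ->
  [/\ pla n s = 'X_[cmon s], mdeg (cmon s) = size s & pweight (cmon s) = sumn s].
Proof.
elim/small_ind => {s} [|i s _ [IH1 IH2 IH3]].
  have -> : cmon [::] = 0%MM by apply/mnmP => i; exact: etrans (mnmE _ _) (esym (mnm0E _)).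
  rewrite /pla big_nil mpolyX0 mdeg0; split=> //.
  by rewrite /pweight big1 // => i _; rewrite mnm0E muln0.
rewrite cmon_cons pla_cons pvarS mpolyXD IH1 mdegD mdeg1 IH2 pweightD IH3.
by rewrite pweightU.
Qed.

Lemma pla_big s : ~~ small s -> all (fun a => 0 < a)%N s -> pla n s = 0.
Proof.
elim: s => //= a s IHs + /andP[a0 s0]; rewrite a0 negb_and -ltnNge pla_cons.
by case/orP=> [/pvar_big->|/IHs->//]; rewrite ?mul0r ?mulr0.
Qed.

Lemma zee_cmon s : small s -> zee s = zmon (cmon s).
Proof.
move=> /allP s_small; rewrite /zee /zmon.
pose G a := (a ^ mult a s * (mult a s)`!)%N.
rewrite -[LHS]/(\prod_(a <- undup s) G a)%N.
rewrite (eq_bigr (fun i : 'I_n => G i.+1)); last by move=> i _; rewrite mnmE.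
rewrite -(big_mkord xpredT (fun i => G i.+1)) -(big_map S xpredT G).
rewrite [RHS](bigID (mem s)) /= [X in (_ * X)%N]big1 ?muln1; last first.
  by move=> a /count_memPn; rewrite /G /mult => ->.
rewrite -[RHS]big_filter; apply: perm_big; apply: uniq_perm.
- exact: undup_uniq.
- by rewrite filter_uniq // map_inj_uniq ?iota_uniq //; exact: succn_inj.
move=> a; rewrite mem_undup mem_filter andb_idr // => /s_small.
case: a => // a lt_an; rewrite mem_map; last exact: succn_inj.
by rewrite mem_index_iota.
Qed.

Definition mon_part m : seq nat := sort geq (flatten [seq nseq (m i) i.+1 | i : 'I_n]).

Lemma mon_partP m : [/\ small (mon_part m), cmon (mon_part m) = m &
  mon_part m \in partitions (pweight m)].
Proof.
have m_small : small (mon_part m).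
  rewrite /small all_sort; apply/allP => a /flatten_mapP[i _] /nseqP[-> _].
  exact: ltn_ord.
have m_cmon : cmon (mon_part m) = m.
  apply/mnmP => i; rewrite mnmE /mult /mon_part count_sort count_flatten.
  rewrite -map_comp sumnE big_map -[LHS]/(\sum_(j <- enum 'I_n) _)%N big_enum /=.
  rewrite (bigD1 i) //= count_nseq /= eqxx mul1n big1 ?addn0 // => j neq_ji.
  by rewrite count_nseq /= eqSS (_ : (j == i :> nat) = false) //; exact: negPf neq_ji.
split=> //; have [_ _] := small_cmon m_small; rewrite m_cmon => ->.
apply/partitionsP; split=> //; first by apply: sort_sorted; exact: geq_total.
by apply: sub_all m_small => a /andP[].
Qed.

(** Only the partition [mon_part m] can contribute to the monomial m. So Q_k is the sum of all
    monomials of weight k divided by their norms; its derivatives and Newton's identities follow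
    coefficientwise. *)
Lemma mcoeff_Qn k m : (Qn n k)@_m = (pweight m == k)%:R / wt m.
Proof.
rewrite /Qn raddf_sum /=.
have [m_small m_cmon m_part] := mon_partP m.
have mcoeff_pla s : s \in partitions k -> s != mon_part m -> (pla n s)@_m = 0.
  move=> s_part neq_s; have [s_sorted s0 sum_s] := partitionsP _ _ s_part.
  have [s_small|/pla_big-> //] := boolP (small s); last by rewrite mcoeff0.
  have [-> _ wt_s] := small_cmon s_small; rewrite mcoeffX; case: eqP => // eq_m.
  case/eqP: neq_s; move: m_part; rewrite -{2}eq_m wt_s sum_s => m_part.
  apply: (eq_partition s_part m_part) => a a0.
  have [le_an|lt_na] := leqP a n.
    case: a a0 le_an => // a _ lt_an.
    have := congr1 (fun m' : 'X_{1..n} => m' (Ordinal lt_an)) (etrans eq_m (esym m_cmon)).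
    by rewrite /= !mnmE.
  have count0 s' : small s' -> count_mem a s' = 0%N.
    by move=> /allP s'_small; apply/count_memPn/negP => /s'_small; lia.
  by rewrite !count0.
case: eqP => [wt_m|neq_k].
  rewrite -wt_m in mcoeff_pla *.
  rewrite (bigD1_seq (mon_part m)) ?undup_uniq //= big_seq_cond big1 ?addr0.
    have [-> size_m _] := small_cmon m_small.
    rewrite mcoeffZ m_cmon mcoeffX eqxx mulr1 /wt mul1r.
    by rewrite (zee_cmon m_small) m_cmon /plen -size_m m_cmon invfM mulrC.
  move=> s /andP[s_part neq_s]; rewrite mcoeffZ mcoeff_pla ?mulr0 //.
rewrite mul0r big_seq big1 // => s s_part; rewrite mcoeffZ mcoeff_pla ?mulr0 //.
apply/eqP => eq_s; case: neq_k.
by have [_ _ <-] := partitionsP _ _ s_part; have [_ _ <-] := partitionsP _ _ m_part; rewrite eq_s.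
Qed.

Lemma dpart_coeff_cancel (K : fieldType) (a b w x i : K) :
  a != 0 -> b != 0 -> w != 0 -> i != 0 ->
  a * b * (x / (w * (a * b) * i) * i) = x / w.
Proof. by move=> a0 b0 w0 i0; field; rewrite a0 b0 w0 i0. Qed.

(** The generating series of the Q_k is exp(sum_i p_i t^i / (alpha i)), on which alpha i d/dp_i
    multiplies by t^i. On coefficients this is a cancellation against the ratio in [wtDU]. *)
Lemma dpart_Qn i k : dpart i (Qn n k) = qsub (Qn n) k i.+1.
Proof.
apply/mpolyP => m; rewrite /dpart mcoeffZ mcoeff_deriv mcoeff_Qn.
rewrite wtDU pweightD pweightU -[_ *+ (m i).+1]mulr_natr.
have a0 := alpha_neq0; have i0 := @natF_neq0 i.+1 isT; have m0 := @natF_neq0 (m i).+1 isT.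
have w0 := wt_neq0 m.
rewrite /qsub; case: ltnP => [le_ik|lt_ki].
  rewrite mcoeff_Qn -{1}(subnK le_ik) eqn_add2r.
  exact: dpart_coeff_cancel.
rewrite mcoeff0 gtn_eqF ?mul0r ?mulr0 //.
by rewrite addnC ltn_addr.
Qed.

Lemma Qn0 : Qn n 0 = 1.
Proof.
apply/mpolyP => m; rewrite mcoeff_Qn mcoeff1.
have -> : (pweight m == 0)%N = (m == 0%MM).
  rewrite -mdeg_eq0; apply/idP/idP => [/eqP wt0|].
    by rewrite -leqn0 -wt0 mdeg_le_pweight.
  by rewrite mdeg_eq0 => /eqP->; rewrite /pweight big1 // => i _; rewrite mnm0E muln0.
case: eqP => [->|]; last by rewrite mul0r.
rewrite /wt mdeg0 /zmon big1 ?mulr1 ?divr1 // => i _; by rewrite mnm0E.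
Qed.

Lemma mcoeff_XnM (i : 'I_n) k f m :
  ('X_i ^+ k * f)@_m = if (k <= m i)%N then f@_(m - U_(i) *+ k)%MM else 0.
Proof.
elim/mpoly_span: f => [f g IH IH'|a f IH||m'].
- by rewrite mulrDr !mcoeffD IH IH'; case: ifP => _; rewrite ?addr0.
- by rewrite -scalerAr !mcoeffZ IH; case: ifP => _; rewrite ?mulr0.
- by rewrite mulr0 !mcoeff0 if_same.
rewrite mpolyXn -mpolyXD !mcoeffX.
have U_k (j : 'I_n) : (U_(i) *+ k)%MM j = ((i == j) * k)%N by rewrite mulmnE mnm1E mulnC.
case: leqP => [le_k|lt_k].
  congr (_%:R); apply: congr1; apply/eqP/eqP => [<-|->].
    by apply/mnmP => j; rewrite mnmBE mnmDE addKn.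
  apply/mnmP => j; rewrite mnmDE mnmBE subnKC // U_k; case: eqP => [<-|_] //.
  by rewrite mul1n.
case: eqP => // eq_m; have := congr1 (fun u : 'X_{1..n} => u i) eq_m.
by rewrite mnmDE U_k eqxx; lia.
Qed.

Lemma mcoeff_euler (i : 'I_n) f m : ('X_i * f^`M(i))@_m = f@_m * (m i)%:R.
Proof.
rewrite -['X_i]expr1 mcoeff_XnM mulm1n mcoeff_deriv; case: posnP => [->|m_i].
  by rewrite mulr0.
rewrite -[LHS]mulr_natr submK; last by rewrite lep1mP -lt0n.
by rewrite mnmBE mnm1E eqxx subn1 prednK.
Qed.

(** By [dpart_Qn] the left side is alpha times the Euler operator of the weight, applied to Q_k,
    which has weight k. *)
Lemma newton_Qn k : \sum_(i < n) 'X_i * qsub (Qn n) k i.+1 = (alpha * k%:R) *: Qn n k.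
Proof.
apply/mpolyP => m; rewrite raddf_sum /= mcoeffZ mcoeff_Qn.
transitivity (\sum_(i < n) alpha * ((pweight m == k)%:R / wt m) * (i.+1 * m i)%N%:R).
  apply: eq_bigr => i _; rewrite -dpart_Qn /dpart -scalerAr mcoeffZ mcoeff_euler.
  by rewrite mcoeff_Qn natrM; ring.
rewrite -mulr_sumr -natr_sum -/(pweight m).
by case: eqP => [->|_]; [exact: mulrAC|rewrite mul0r !mulr0 mul0r].
Qed.

End CompleteFunctions.

(** Induction on b, comparing (a, b + 1) with (a + 1, b): the double sums agree except for the terms
    j = 0 of the former and i = 0 of the latter. Each of these is a Newton sum deprived of its p_1
    term, and the two p_1 terms cancel. *)
Lemma newton_convolution (R : comNzRingType) (p q : nat -> R) (c : R) :
  (forall a, \sum_(i < a) p i.+1 * q (a - i.+1)%N = c * a%:R * q a) ->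
  forall a b,
  \sum_(i < a) \sum_(j < b) p (i + j).+2 * (q (a - i.+1)%N * q (b - j.+1)%N) =
  c * (\sum_(k < b) ((a + 2 * k.+1)%N%:R - b%:R) * (q (a + k.+1)%N * q (b - k.+1)%N))
  - c * b%:R * (q a * q b).
Proof.
move=> newton a b.
have newtonS k : \sum_(i < k) p i.+2 * q (k - i.+1)%N = c * k.+1%:R * q k.+1 - p 1%N * q k.
  by rewrite -newton big_ord_recl /= subn1 /= addrC addKr.
elim: b a => [|b IHb] a.
  rewrite big_ord0 !mulr0 mul0r subr0; apply: big1 => i _; exact: big_ord0.
transitivity (\sum_(i < a.+1) \sum_(j < b)
    p (i + j).+2 * (q (a.+1 - i.+1)%N * q (b - j.+1)%N)
    + q b * (c * a.+1%:R * q a.+1 - p 1%N * q a)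
    - q a * (c * b.+1%:R * q b.+1 - p 1%N * q b)).
  rewrite -!newtonS [in RHS]big_ord_recl /= !mulr_sumr.
  rewrite (eq_bigr (fun i : 'I_a => q b * (p i.+2 * q (a - i.+1)%N) +
     \sum_(j < b) p (i.+1 + j).+2 * (q (a - i.+1)%N * q (b - j.+1)%N))).
    rewrite big_split /= [X in X + _ + _ - _](eq_bigr (fun j : 'I_b =>
        q a * (p j.+2 * q (b - j.+1)%N))); last by move=> j _; rewrite subn1 /=; ring.
    by ring.
  move=> i _; rewrite big_ord_recl /= addn0 subn1 /=; congr (_ + _); first by ring.
  by apply: eq_bigr => j _; rewrite addnS addSn.
rewrite IHb big_ord_recl /= addn1 subn1 /=.
rewrite [in RHS](eq_bigr (fun k : 'I_b => ((a.+1 + 2 * k.+1)%N%:R - b%:R) *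
    (q (a.+1 + k.+1)%N * q (b - k.+1)%N))); last first.
  move=> k _; rewrite [bump _ _]add1n subSS; congr (_ * _); first by ring.
  by rewrite addSnnS.
by ring.
Qed.

(** * Duality of the q's with the monomials in x_1, ..., x_n *)

Section Duality.
Variable n : nat.
Implicit Types (f g h : {mpoly F[n]}) (m : 'X_{1..n}) (s : seq nat).

Lemma qq_cons a s : qq n (a :: s) = Qn n a * qq n s.
Proof. by rewrite /qq big_cons. Qed.

Lemma dpart_qq (i : 'I_n) s : dpart i (qq n s) =
  \sum_(j < size s | (i < nth 0 s j)%N) qq n (set_nth 0%N s j (nth 0 s j - i.+1)%N).
Proof.
elim: s => [|a s IHs]; first by rewrite /qq big_nil dpart1 big_ord0.
rewrite qq_cons dpartM IHs dpart_Qn [RHS]big_mkcond /= big_ord_recl /= qq_cons.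
congr (_ + _); first by rewrite /qsub; case: ifP => // _; rewrite mul0r.
rewrite [in LHS]big_mkcond mulr_sumr; apply: eq_bigr => j _ /=.
by case: ifP => _; rewrite ?mulr0 // -qq_cons.
Qed.

Definition lmon s : 'X_{1..n} := [multinom nth 0%N s i | i < n].

Lemma evD : {morph @ev n : f g / f + g}.
Proof. exact: comp_mpolyD. Qed.

Lemma evZ a f : ev (a *: f) = a *: ev f.
Proof. exact: comp_mpolyZ. Qed.

Lemma evXM i f : ev ('X_i * f) = psum n i.+1 * ev f.
Proof.
by rewrite /ev rmorphM /= comp_mpolyXU (nth_map i) ?size_enum_ord // nth_ord_enum.
Qed.

Lemma pweight0 : pweight (0%MM : 'X_{1..n}) = 0%N.
Proof. by rewrite /pweight big1 // => i _; rewrite mnm0E muln0. Qed.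

Lemma wt0 : wt (0%MM : 'X_{1..n}) = 1.
Proof.
rewrite /wt mdeg0 expr0 mul1r /zmon big1 // => i _; by rewrite mnm0E.
Qed.

Lemma mcoeff0_qq s : (qq n s)@_0%MM = (all (pred1 0%N) s)%:R.
Proof.
elim: s => [|a s IHs]; first by rewrite /qq big_nil mcoeff1 eqxx.
rewrite qq_cons rmorphM /= IHs mcoeff_Qn pweight0 wt0 divr1 eq_sym.
by case: eqP; rewrite ?mul1r ?mul0r.
Qed.

(* Multiplication by p_k is adjoint to alpha k d/dp_k, which sends Q_a to
   Q_(a-k); on the side of the x's, p_k shifts the coefficients likewise. *)
Lemma qq_dual s g : (size s <= n)%N -> scal (qq n s) g = (ev g)@_(lmon s).
Proof.
elim/mpoly_span: g s => [f g IHf IHg|a f IH||m] s size_s.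
- by rewrite scalDr evD mcoeffD IHf ?IHg.
- by rewrite scalZr evZ mcoeffZ IH.
- by rewrite scal0r /ev comp_mpoly0 mcoeff0.
move: {2}(mdeg m) (erefl (mdeg m)) => d; elim: d m s size_s => [|d IHd] m s size_s.
  move/eqP; rewrite mdeg_eq0 => /eqP->; rewrite mpolyX0 /ev comp_mpoly1 mcoeff1.
  rewrite -mpolyX0 scalC scalXl wt0 mulr1 mcoeff0_qq.
  congr (_%:R); congr nat_of_bool; apply/esym.
  apply/eqP/allP => [s0 a a_s|s0].
    rewrite -(nth_index 0%N a_s); have lt_a : (index a s < n)%N.
      by apply: leq_trans size_s; rewrite index_mem.
    have := congr1 (fun u : 'X_{1..n} => u (Ordinal lt_a)) s0.
    by rewrite mnmE mnm0E /= => ->.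
  apply/mnmP => i; rewrite mnmE mnm0E; have [lt_i|le_i] := ltnP i (size s).
    by apply/eqP; apply: s0; rewrite mem_nth.
  by rewrite nth_default.
move=> deg_m; have /existsP[i m_i] : [exists i, m i != 0%N].
  apply/existsPn => m0; move: deg_m; rewrite mdegE big1 // => i _.
  by apply/eqP; have := m0 i; rewrite negbK.
have -> : m = (U_(i) + (m - U_(i)))%MM by rewrite addmC submK // lep1mP.
set m' := (m - U_(i))%MM; have deg_m' : mdeg m' = d.
  have : mdeg m = (mdeg m').+1 by rewrite -{1}(submK (m := U_(i)) (m' := m)) ?lep1mP // mdegD mdeg1 addn1.
  by rewrite deg_m => -[].
rewrite mpolyXD scalC scal_mulX scalC dpart_qq scal_suml evXM /psum mulr_suml raddf_sum /=.
under eq_bigr => j _.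
  rewrite (IHd m') //; last by rewrite size_set_nth; move: (ltn_ord j) size_s; lia.
over.
under [RHS]eq_bigr => j _ do rewrite mcoeff_XnM mnmE.
rewrite -[RHS]big_mkcond /= [LHS]big_mkcond.
(* Positions beyond the end of s hold the default 0, so the remaining x's contribute nothing. *)
rewrite (big_ord_widen_cond n xpredT (fun j => if (i < nth 0%N s j)%N then
  (ev 'X_[m'])@_(lmon (set_nth 0%N s j (nth 0%N s j - i.+1)%N)) else 0)) //=.
rewrite [RHS]big_mkcond [LHS]big_mkcond /=; apply: eq_bigr => j _.
case: ltnP => [lt_j|le_j]; last by rewrite nth_default.
case: ifP => [lt_i|_]; last by [].
congr (_@_ _); apply/mnmP => l.
rewrite mnmBE !mnmE mulmnE mnm1E nth_set_nth /= -val_eqE /= eq_sym.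
by case: eqP => [->|_]; rewrite ?mul1n ?subn0.
Qed.

End Duality.

(** * The Laplace-Beltrami operator *)
Section LaplaceBeltrami.
Variables (A : comNzRingType) (n : nat).
Variables (c : A) (x : 'I_n -> A) (p q : nat -> A).
Variables (d : 'I_n -> A -> A) (dv : nat -> A -> A).
Implicit Types (f g h : A).

(** An operator of cut-and-join type in three pieces: two power sums merge, one splits into two, and
    a diagonal term. Only [fuse] is of second order. With x, p, q, d abstract, the computation rests
    on derivation rules and values on the q's alone. *)
Definition fuse f := \sum_(i < n) \sum_(j < n) p (i + j).+2 * d i (d j f).

Definition cut f := \sum_(i < n) \sum_(j < n) x i * (x j * dv (i + j).+1 f).

Definition stay f := \sum_(i < n) i.+1%:R * (x i * d i f).

(** Polarisation of [fuse]; it measures how far [lapl] is from being a derivation. *)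
Definition cross f g := \sum_(i < n) \sum_(j < n) p (i + j).+2 * (d i f * d j g).

(* With [x i = p (i + 1)], [d i = alpha (i + 1) d/dp_(i + 1)] and [c = alpha],
   this is [2 alpha] times the Laplace-Beltrami operator, up to a multiple of
   the degree. *)
Definition lapl f := fuse f + cut f + (c - 1) * stay f.

Local Notation qs := (qsub q).

Lemma crossC f g : cross f g = cross g f.
Proof.
rewrite /cross exchange_big; apply: eq_bigr => i _; apply: eq_bigr => j _.
by rewrite addnC (mulrC (d j f)).
Qed.

Section Derivations.
Hypothesis dD : forall i, {morph d i : f g / f + g}.
Hypothesis dM : forall i f g, d i (f * g) = d i f * g + f * d i g.
Hypothesis dvM : forall k f g, dv k (f * g) = dv k f * g + f * dv k g.

Lemma crossMr f g h : cross f (g * h) = cross f g * h + g * cross f h.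
Proof.
rewrite /cross mulr_suml mulr_sumr -big_split; apply: eq_bigr => i _ /=.
rewrite mulr_suml mulr_sumr -big_split; apply: eq_bigr => j _ /=.
by rewrite dM; ring.
Qed.

Lemma laplM f g : lapl (f * g) = lapl f * g + f * lapl g + (cross f g) *+ 2.
Proof.
have fuseM : fuse (f * g) = fuse f * g + f * fuse g + (cross f g + cross g f).
  rewrite /fuse /cross !mulr_suml !mulr_sumr -!big_split; apply: eq_bigr => i _ /=.
  rewrite !mulr_suml !mulr_sumr -!big_split; apply: eq_bigr => j _ /=.
  by rewrite !(dM, dD); ring.
have cutM : cut (f * g) = cut f * g + f * cut g.
  rewrite /cut !mulr_suml !mulr_sumr -!big_split; apply: eq_bigr => i _ /=.
  rewrite !mulr_suml !mulr_sumr -!big_split; apply: eq_bigr => j _ /=.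
  by rewrite dvM; ring.
have stayM : stay (f * g) = stay f * g + f * stay g.
  rewrite /stay !mulr_suml !mulr_sumr -!big_split; apply: eq_bigr => i _ /=.
  by rewrite dM; ring.
by rewrite /lapl fuseM cutM stayM (crossC g); ring.
Qed.

End Derivations.

Section CompleteFunctions.
Hypothesis px : forall i : 'I_n, p i.+1 = x i.
Hypothesis p0 : forall k, (n <= k)%N -> p k.+1 = 0.
Hypothesis d0 : forall i, d i 0 = 0.
Hypothesis dq : forall i k, d i (q k) = qs k i.+1.
Hypothesis dvq : forall i k, (k <= n)%N -> dv i (q k) = qs k i.+1.
Hypothesis newton : forall k, \sum_(i < n) x i * qs k i.+1 = c * k%:R * q k.

Lemma d_qsub (i : 'I_n) k j : d i (qs k j) = qs k (j + i.+1).
Proof.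
rewrite /qsub; case: (leqP j k) => [le_jk|lt_kj].
  by rewrite dq /qsub leq_subRL // -subnDA.
by rewrite d0 leqNgt (leq_trans lt_kj) // leq_addr.
Qed.

(** Reconciles two truncations: sums over the n variables, where q of negative index vanishes, and
    sums up to the degree k, where H vanishes from n on. *)
Lemma sum_qsub (H : nat -> A) k : (forall j, (n <= j)%N -> H j = 0) ->
  \sum_(j < n) H j * qs k j.+1 = \sum_(j < k) H j * q (k - j.+1)%N.
Proof.
move=> H0.
rewrite (big_ord_widen (n + k) (fun j => H j * qs k j.+1)) ?leq_addr //.
rewrite (big_ord_widen (n + k) (fun j => H j * q (k - j.+1)%N)) ?leq_addl //.
rewrite big_mkcond [RHS]big_mkcond; apply: eq_bigr => j _ /=.
case: ltnP => [_|le_nj]; last by rewrite H0 // mul0r if_same.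
by rewrite /qsub; case: ifP => _; rewrite ?mulr0.
Qed.

Lemma newton_full a : \sum_(i < a) p i.+1 * q (a - i.+1)%N = c * a%:R * q a.
Proof.
rewrite -(@sum_qsub (fun i => p i.+1)); last exact: p0.
by rewrite -newton; apply: eq_bigr => i _; rewrite px.
Qed.

Lemma cross_q a b : cross (q a) (q b) =
  c * (\sum_(k < b) ((a + 2 * k.+1)%N%:R - b%:R) * (q (a + k.+1)%N * q (b - k.+1)%N))
  - c * b%:R * (q a * q b).
Proof.
rewrite -(newton_convolution newton_full) /cross.
transitivity (\sum_(i < n) (\sum_(j < b) p (i + j).+2 * q (b - j.+1)%N) * qs a i.+1).
  apply: eq_bigr => i _; rewrite -(@sum_qsub (fun j => p (i + j).+2)).
    by rewrite mulr_suml; apply: eq_bigr => j _; rewrite !dq; ring.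
  by move=> j le_nj; apply: p0; lia.
rewrite (@sum_qsub (fun i => \sum_(j < b) p (i + j).+2 * q (b - j.+1)%N)).
  by apply: eq_bigr => i _; rewrite mulr_suml; apply: eq_bigr => j _; ring.
by move=> i le_ni; rewrite big1 // => j _; rewrite p0 ?mul0r //; lia.
Qed.

(** There are t pairs with i + j + 1 = t, and for t < n all of them lie in the square. *)
Lemma sum_diag (H : nat -> A) : (forall t, (n <= t)%N -> H t = 0) ->
  \sum_(i < n) \sum_(j < n) H (i + j).+1 = \sum_(t < n) t%:R * H t.
Proof.
move=> H0; transitivity (\sum_(i < n) \sum_(t < n | (i < t)%N) H t).
  apply: eq_bigr => i _.
  rewrite -(big_geq_mkord i.+1 n xpredT H) -{1}[i.+1]add0n big_addn big_mkord.
  rewrite (big_ord_widen n (fun j => H (j + i.+1)%N)) ?leq_subr //.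
  rewrite [RHS]big_mkcond; apply: eq_bigr => j _ /=; rewrite addnC -addnS.
  by case: ltnP => // le_j; rewrite H0 //; lia.
rewrite (exchange_big_dep xpredT) //=; apply: eq_bigr => t _.
rewrite -(big_ord_widen n (fun _ => H t)) ?(ltnW (ltn_ord t)) //.
by rewrite sumr_const card_ord mulr_natl.
Qed.

(** With S = sum_i i p_i q_(a-i), [fuse] gives S - c a q_a, [cut] gives (c a)^2 q_a - c S and [stay]
    gives S; the weight c - 1 makes S cancel. The bound on a is the one under which [dvq] holds. *)
Lemma lapl_q a : (a <= n)%N -> lapl (q a) = c * a%:R * (c * a%:R - 1) * q a.
Proof.
move=> le_an; pose S := \sum_(i < n) i.+1%:R * (x i * qs a i.+1).
have fuseQ : fuse (q a) = S - c * a%:R * q a.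
  transitivity (\sum_(i < n) \sum_(j < n) p (i + j).+2 * qs a (i + j).+2).
    apply: eq_bigr => i _; apply: eq_bigr => j _.
    by rewrite dq d_qsub addSn addnS addnC.
  rewrite (@sum_diag (fun t => p t.+1 * qs a t.+1)); last first.
    by move=> t le_nt; rewrite p0 ?mul0r.
  by rewrite /S -newton -sumrB; apply: eq_bigr => i _; rewrite px; ring.
have stayQ : stay (q a) = S by apply: eq_bigr => i _; rewrite dq.
have cutQ : cut (q a) = c * a%:R * (c * a%:R * q a) - c * S.
  transitivity (\sum_(i < n) x i * (c * (a%:R - i.+1%:R) * qs a i.+1)).
    apply: eq_bigr => i _; rewrite -mulr_sumr; congr (_ * _).
    rewrite (eq_bigr (fun j : 'I_n => x j * d j (qs a i.+1))); last first.
      by move=> j _; rewrite dvq // d_qsub addSn addnS.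
    rewrite /qsub; case: ifP => [le_ia|_]; last first.
      by rewrite big1 ?mulr0 // => j _; rewrite d0 mulr0.
    under eq_bigr do rewrite dq.
    by rewrite newton natrB.
  by rewrite -newton /S !mulr_sumr -sumrB; apply: eq_bigr => i _; ring.
by rewrite /lapl fuseQ cutQ stayQ; ring.
Qed.

Section Products.
Hypothesis dD : forall i, {morph d i : f g / f + g}.
Hypothesis dM : forall i f g, d i (f * g) = d i f * g + f * d i g.
Hypothesis d1 : forall i, d i 1 = 0.
Hypothesis dvM : forall k f g, dv k (f * g) = dv k f * g + f * dv k g.
Hypothesis dv1 : forall k, dv k 1 = 0.

Definition qprod s := \prod_(a <- s) q a.

Lemma qprod_cons a s : qprod (a :: s) = q a * qprod s.
Proof. exact: big_cons. Qed.

Lemma cross_qprod a s : cross (q a) (qprod s) =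
  c * (\sum_(j < size s) \sum_(k < nth 0%N s j)
         ((a + 2 * k.+1)%N%:R - (nth 0%N s j)%:R) *
         (q (a + k.+1)%N * qprod (set_nth 0 s j (nth 0 s j - k.+1))%N))
  - c * (sumn s)%:R * (q a * qprod s).
Proof.
elim: s => [|b s IHs].
  rewrite big_ord0 !mulr0 mul0r subr0 /qprod big_nil /cross.
  by rewrite big1 // => i _; rewrite big1 // => j _; rewrite d1 !mulr0.
rewrite qprod_cons crossMr // IHs cross_q big_ord_recl /=.
rewrite [in RHS](eq_bigr (fun j : 'I_(size s) => q b * \sum_(k < nth 0%N s j)
         ((a + 2 * k.+1)%N%:R - (nth 0%N s j)%:R) *
         (q (a + k.+1)%N * qprod (set_nth 0 s j (nth 0 s j - k.+1))%N))); last first.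
  move=> j _; rewrite add0n mulr_sumr; apply: eq_bigr => k _.
  by rewrite qprod_cons; ring.
rewrite -mulr_sumr.
rewrite [in RHS](eq_bigr (fun k : 'I_b => ((a + 2 * k.+1)%N%:R - b%:R) *
         (q (a + k.+1)%N * q (b - k.+1)%N) * qprod s)); last first.
  by move=> k _; rewrite qprod_cons; ring.
by rewrite -mulr_suml natrD; ring.
Qed.

(** The diagonal coefficient divided by c: c a^2 - a comes from [lapl_q], and -2 |s'| from the last
    term of [cross_qprod], which counts twice. It will turn out to be 2 e' + |s|. *)
Fixpoint eigen s : A :=
  if s is a :: s' then c * (a ^ 2)%N%:R - a%:R - (2 * sumn s')%N%:R + eigen s' else 0.

Lemma lapl_qprod s : all (fun a => a <= n)%N s ->
  lapl (qprod s) = c * eigen s * qprod s +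
  c * (\sum_(i < size s) \sum_(j < size s | (i < j)%N) \sum_(k < nth 0%N s j)
         ((nth 0 s i + 2 * k.+1)%N%:R - (nth 0%N s j)%:R) * qprod (raw_move s i j k.+1)) *+ 2.
Proof.
elim: s => [_|a s IHs /= /andP[le_an /IHs{}IHs]].
  rewrite /qprod big_nil /= big_ord0 !mulr0 mul0r mul0rn addr0 /lapl /fuse /cut /stay.
  rewrite big1 ?add0r => [|i _]; last first.
    by rewrite big1 // => j _; rewrite d1 d0 mulr0.
  rewrite big1 ?add0r => [|i _]; last first.
    by rewrite big1 // => j _; rewrite dv1 !mulr0.
  by rewrite big1 ?mulr0 // => i _; rewrite d1 !mulr0.
rewrite qprod_cons laplM // IHs lapl_q // cross_qprod big_ord_recl /=.
rewrite [X in _ = _ + c * (X + _) *+ 2]big_mkcond big_ord_recl /= add0r.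
rewrite [in RHS](eq_bigr (fun j : 'I_(size s) => \sum_(k < nth 0%N s j)
         ((a + 2 * k.+1)%N%:R - (nth 0%N s j)%:R) *
         (q (a + k.+1)%N * qprod (set_nth 0 s j (nth 0 s j - k.+1))%N))); last first.
  by move=> j _; rewrite add0n; apply: eq_bigr => k _; rewrite -qprod_cons.
rewrite [X in _ = _ + c * (_ + X) *+ 2](eq_bigr (fun i : 'I_(size s) => q a *
   \sum_(j < size s | (i < j)%N) \sum_(k < nth 0%N s j)
         ((nth 0 s i + 2 * k.+1)%N%:R - (nth 0%N s j)%:R) * qprod (raw_move s i j k.+1))); last first.
  move=> i _; rewrite big_mkcond big_ord_recl /= add0r mulr_sumr [RHS]big_mkcond.
  apply: eq_bigr => j _. rewrite ![bump _ _]add1n ltnS.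
  case: ifP => // _; rewrite mulr_sumr; apply: eq_bigr => k _.
  by rewrite mulrCA -qprod_cons.
by rewrite -mulr_sumr !natrM; ring.
Qed.

End Products.

End CompleteFunctions.

End LaplaceBeltrami.

Lemma eprime_split (R : comNzRingType) (c x y h a b e : R) :
  c * (x + y) * h - (a + (b + e)) = c * x * h - a - b + (c * y * h - e).
Proof. by ring. Qed.

Lemma eigenvalue_shift (K : fieldType) (c e k : K) : 2%:R != 0 :> K -> c != 0 ->
  (2%:R * c)^-1 * (c * (2%:R * e + k)) - k / 2%:R = e.
Proof. by move=> two0 c0; field; rewrite two0 c0. Qed.

Lemma eigen_split (R : comNzRingType) (c x h a b e : R) : 2%:R * h = 1 ->
  c * x - a - 2%:R * b + (2%:R * e + b) = 2%:R * (c * x * h - a - b + e) + (a + b).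
Proof.
by move=> h2; rewrite -[c * x in LHS]mulr1 -[X in c * x * X]h2; ring.
Qed.

(** * The operator on power sums: self-adjointness and action on the q's *)

Section LaplaceBeltramiOnJack.
Variable n : nat.
Implicit Types (f g h : {mpoly F[n]}) (s t : seq nat).

(* Adjoint of the multiplication by p_(k+1), which vanishes for k >= n. *)
Definition dvar k f : {mpoly F[n]} := if insub k is Some i then dpart i f else 0.

Lemma scal_pvar k f g : scal (pvar n k.+1 * f) g = scal f (dvar k g).
Proof.
rewrite /pvar /dvar; case: insubP => [i _ _|_]; first exact: scal_mulX.
by rewrite mul0r scalC !scal0r.
Qed.

Lemma dvarM k f g : dvar k (f * g) = dvar k f * g + f * dvar k g.
Proof.
rewrite /dvar; case: insubP => [i _ _|_]; first exact: dpartM.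
by rewrite mul0r mulr0 addr0.
Qed.

Lemma dvar1 k : dvar k 1 = 0.
Proof. by rewrite /dvar; case: insubP => // i _ _; exact: dpart1. Qed.

Lemma dpart0 (i : 'I_n) : dpart i 0 = 0 :> {mpoly F[n]}.
Proof. by rewrite /dpart mderiv0 scaler0. Qed.

Lemma dvar_Qn k a : (a <= n)%N -> dvar k (Qn n a) = qsub (Qn n) a k.+1.
Proof.
move=> le_an; rewrite /dvar; case: insubP => [i _ <-|]; first exact: dpart_Qn.
by rewrite -leqNgt /qsub => le_nk; case: ifP => //; lia.
Qed.

Definition xvar (i : 'I_n) : {mpoly F[n]} := 'X_i.
Definition cst (a : F) : {mpoly F[n]} := a%:MP.

Definition mfuse f := fuse (pvar n) (@dpart n) f.
Definition mcut f := cut xvar dvar f.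
Definition mstay f := stay xvar (@dpart n) f.
Definition mlapl f := lapl (cst alpha) xvar (pvar n) (@dpart n) dvar f.

Lemma mlaplE f : mlapl f = mfuse f + mcut f + (alpha - 1) *: mstay f.
Proof. by rewrite -mul_mpolyC mpolyCB mpolyC1. Qed.

(** Factorwise adjoints turn p_(i+j) D_i D_j into p_i p_j D_(i+j); for i + j > n both vanish by
    convention. *)
Lemma scal_fuse f g : scal (mfuse f) g = scal f (mcut g).
Proof.
rewrite /mfuse /mcut /fuse /cut scal_suml scal_sumr.
under eq_bigr do rewrite scal_suml.
under [RHS]eq_bigr do rewrite scal_sumr.
rewrite exchange_big /=; apply: eq_bigr => j _; apply: eq_bigr => i _.
by rewrite scal_pvar !scal_dpart addnC.
Qed.

Lemma scal_stay f g : scal (mstay f) g = scal f (mstay g).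
Proof.
rewrite /mstay /stay scal_suml scal_sumr; apply: eq_bigr => i _.
have scale_nat k h : k%:R * h = k%:R *: h by rewrite mulr_natl scaler_nat.
rewrite (scale_nat _ (xvar i * dpart i f)) (scale_nat _ (xvar i * dpart i g)).
by rewrite scalZl scalZr scal_mulX scal_dpart.
Qed.

Lemma scal_mlapl f g : scal (mlapl f) g = scal f (mlapl g).
Proof.
rewrite !mlaplE !scalDl !scalDr scal_fuse [scal f (mfuse g)]scalC scal_fuse.
by rewrite (scalC g) scalZl scalZr scal_stay; congr (_ + _); exact: addrC.
Qed.

Lemma newton_mpoly k :
  \sum_(i < n) xvar i * qsub (Qn n) k i.+1 = cst alpha * k%:R * Qn n k.
Proof. by rewrite newton_Qn -mul_mpolyC mpolyCM mpolyC_nat. Qed.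

Lemma eprime_cons a s : eprime (a :: s) =
  alpha * (a ^ 2)%N%:R / 2%:R - a%:R - (sumn s)%:R + eprime s.
Proof.
rewrite /eprime /= !big_ord_recl /= mul1n.
rewrite [X in _ - (_ + X) = _](eq_bigr (fun i : 'I_(size s) => (nth 0%N s i)%:R + (i.+1 * nth 0%N s i)%N%:R)).
  rewrite big_split /=.
  have -> : \sum_(i < size s) (nth 0%N s i)%:R = (sumn s)%:R :> F.
    by rewrite -natr_sum sumnE (big_nth 0%N) big_mkord.
  exact: eprime_split.
by move=> i _; rewrite [bump _ _]add1n mulSn natrD.
Qed.

Lemma eigenE s : eigen (cst alpha) s = cst (2%:R * eprime s + (sumn s)%:R).
Proof.
elim: s => [|a s IHs] /=.
  by rewrite /eprime !big_ord0 mulr0 mul0r subr0 mulr0 addr0 /cst mpolyC0.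
rewrite IHs eprime_cons /cst -!mpolyC_nat -mpolyCM -!mpolyCB -mpolyCD; congr (_%:MP).
by rewrite !natrM natrD; apply: eigen_split; rewrite mulfV // natF_neq0.
Qed.

Lemma mlapl_qq s : all (fun a => a <= n)%N s ->
  mlapl (qq n s) = (alpha * (2%:R * eprime s + (sumn s)%:R)) *: qq n s +
  (2%:R * alpha) *: \sum_(t <- move_triples s)
    ((nth 0%N s t.1.1 + 2 * t.2)%N%:R - (nth 0%N s t.1.2)%:R) *:
      qq n (raw_move s t.1.1 t.1.2 t.2).
Proof.
move=> s_le; rewrite /mlapl -[qq n s]/(qprod (Qn n) s).
rewrite (lapl_qprod _ _ dpart0 (@dpart_Qn n) dvar_Qn newton_mpoly (@dpartD n)
  (@dpartM n) (@dpart1 n) dvarM dvar1 s_le).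
- rewrite eigenE /cst -mpolyCM mul_mpolyC; congr (_ + _).
  rewrite mul_mpolyC scalerMnl; congr (_ *: _); first by rewrite mulr_natl.
  rewrite (sum_move_triples (fun i j k =>
    ((nth 0%N s i + 2 * k)%N%:R - (nth 0%N s j)%:R) *: qq n (raw_move s i j k))).
  do 3![apply: eq_bigr => ? _].
  by rewrite -mul_mpolyC mpolyCB !mpolyC_nat.
- exact: pvarS.
- by move=> k le_nk; apply: pvar_big.
Qed.

Lemma qq_perm s t : perm_eq s t -> qq n s = qq n t.
Proof. exact: perm_big. Qed.

Lemma qq_filter s : qq n [seq a <- s | 0 < a]%N = qq n s.
Proof.
elim: s => //= -[|a] s IHs; last by rewrite !qq_cons IHs.
by rewrite qq_cons Qn0 mul1r.
Qed.

Lemma qq_sort_pos s : qq n (sort geq [seq a <- s | 0 < a]%N) = qq n s.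
Proof. by rewrite -[RHS]qq_filter; apply: qq_perm; rewrite perm_sort. Qed.

Lemma partition_le s : s \in partitions n -> all (fun a => a <= n)%N s.
Proof.
case/partitionsP=> _ _ <-; apply/allP => a; exact: mem_le_sumn.
Qed.

(** [mlapl] has diagonal coefficient alpha (2 e' + n) on partitions of n; this normalisation leaves
    exactly e'. *)
Definition LB f := (2%:R * alpha)^-1 *: mlapl f - (n%:R / 2%:R) *: f.

Lemma scal_LB f g : scal (LB f) g = scal f (LB g).
Proof. by rewrite /LB scalBl scalBr !scalZl !scalZr scal_mlapl. Qed.

Lemma scal_inj f g : (forall h, scal h f = scal h g) -> f = g.
Proof.
move=> eq_fg; apply/mpolyP => m; apply: (mulIf (wt_neq0 m)).
by rewrite -!scalXl eq_fg.
Qed.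

(** Linearity is read off from self-adjointness and the nondegeneracy of the form. *)
Lemma LB_sum (I : Type) (r : seq I) (c : I -> F) (G : I -> {mpoly F[n]}) :
  LB (\sum_(i <- r) c i *: G i) = \sum_(i <- r) c i *: LB (G i).
Proof.
apply: scal_inj => h; rewrite -scal_LB !scal_sumr; apply: eq_bigr => i _.
by rewrite !scalZr scal_LB.
Qed.

Lemma LB_qq s : s \in partitions n ->
  LB (qq n s) = eprime s *: qq n s + \sum_(t <- partitions n) rcoef s t *: qq n t.
Proof.
move=> s_part; have [_ _ sum_s] := partitionsP _ _ s_part.
rewrite /LB mlapl_qq ?partition_le // scalerDr !scalerA addrAC -scalerBl sum_s.
have two0 : 2%:R != 0 :> F by exact: natF_neq0.
congr (_ *: _ + _); first exact: eigenvalue_shift two0 alpha_neq0.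
rewrite (mulVf (mulf_neq0 two0 alpha_neq0)) scale1r.
under [RHS]eq_bigr do rewrite (rcoefE _ s_part) scaler_suml big_mkcond.
rewrite exchange_big /=; apply: eq_big_seq => u.
rewrite mem_move_triples => /and4P[ij js k0 kj].
rewrite [RHS](bigD1_seq (moveup s u.1.1 u.1.2 u.2)) ?undup_uniq //=; last first.
  exact: moveup_partition.
rewrite eqxx big1 ?addr0 => [|t /negPf]; last by rewrite eq_sym => ->.
by rewrite /moveup qq_sort_pos.
Qed.

Definition in_span f := exists c : seq nat -> F, f = \sum_(s <- partitions n) c s *: qq n s.

Lemma in_spanD f g : in_span f -> in_span g -> in_span (f + g).
Proof.
case=> c -> [d ->]; exists (fun s => c s + d s); rewrite -big_split.
by apply: eq_bigr => s _; rewrite scalerDl.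
Qed.

Lemma in_spanZ a f : in_span f -> in_span (a *: f).
Proof.
case=> c ->; exists (fun s => a * c s); rewrite scaler_sumr.
by apply: eq_bigr => s _; rewrite scalerA.
Qed.

Lemma in_span0 : in_span 0.
Proof. by exists (fun _ => 0); rewrite big1 // => s _; rewrite scale0r. Qed.

Lemma in_span_sum (I : Type) (r : seq I) (p : pred I) (G : I -> {mpoly F[n]}) :
  (forall i, p i -> in_span (G i)) -> in_span (\sum_(i <- r | p i) G i).
Proof. move=> G_span; elim/big_ind: _ => //; [exact: in_span0|exact: in_spanD]. Qed.

Lemma in_span_qq s : sumn s = n -> in_span (qq n s).
Proof.
move=> sum_s; set t := sort geq [seq a <- s | 0 < a]%N.
have t_part : t \in partitions n.
  apply/partitionsP; split; first by apply: sort_sorted; exact: geq_total.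
    by rewrite all_sort filter_all.
  by rewrite sumn_sort_pos.
exists (fun u => (u == t)%:R); rewrite (bigD1_seq t) ?undup_uniq //= eqxx scale1r.
rewrite big1 ?addr0 => [|u /negPf->]; last by rewrite scale0r.
by rewrite qq_sort_pos.
Qed.

(* Newton's identity trades p_a for the Q_b and the p_b with b < a. *)
Lemma in_span_pla t s : all (fun a => 0 < a)%N t -> (sumn t + sumn s = n)%N ->
  in_span (pla n t * qq n s).
Proof.
elim: t s => [|a t IHt] s /=.
  by move=> _ sum_s; rewrite /pla big_nil mul1r; apply: in_span_qq.
case/andP=> a0 t0; elim/ltn_ind: a s a0 => -[//|a] IHa s _ sum_s.
have newton_a : pvar n a.+1 = (alpha * a.+1%:R) *: Qn n a.+1 -
    \sum_(i < a) pvar n i.+1 * Qn n (a.+1 - i.+1).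
  rewrite -mul_mpolyC mpolyCM mpolyC_nat.
  rewrite -(newton_full (x := xvar) (p := pvar n) (@pvarS n) (fun k => @pvar_big n k.+1) newton_mpoly).
  by rewrite big_ord_recr /= subnn Qn0 mulr1 addrAC subrr add0r.
rewrite pla_cons newton_a mulrBl mulrBl; apply: in_spanD.
  rewrite -!scalerAl; apply: in_spanZ; rewrite (mulrC (Qn n _)) -mulrA -qq_cons.
  by apply: IHt => //=; rewrite addnCA addnA.
rewrite -scaleN1r; apply: in_spanZ; rewrite !mulr_suml; apply: in_span_sum => i _.
rewrite -mulrA mulrACA -pla_cons -qq_cons.
by apply: IHa => //=; move: (ltn_ord i); lia.
Qed.

Lemma in_span_homog f : homog_deg n f -> in_span f.
Proof.
move=> f_homog; rewrite [f]mpolyE big_seq; apply: in_span_sum => m m_f.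
have [m_small m_cmon m_part] := mon_partP m; apply: in_spanZ.
rewrite (f_homog m m_f) in m_part; have [_ m0 sum_m] := partitionsP _ _ m_part.
have [pla_m _ _] := small_cmon m_small; rewrite -m_cmon -pla_m.
have -> : pla n (mon_part m) = pla n (mon_part m) * qq n [::].
  by rewrite /qq big_nil mulr1.
by apply: in_span_pla; rewrite ?addn0.
Qed.

End LaplaceBeltramiOnJack.

(** * Moving up filtrations *)
Lemma dom_le_anti n s t : s \in partitions n -> t \in partitions n ->
  dom_le s t -> dom_le t s -> s = t.
Proof.
move=> s_part t_part le_st le_ts; apply/eqP/negP => /negP neq_st.
have := dom_lt_nstat s_part t_part (introT andP (conj le_st neq_st)).
have neq_ts : t != s by rewrite eq_sym.
by have := dom_lt_nstat t_part s_part (introT andP (conj le_ts neq_ts)); lia.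
Qed.

Section Chains.
Variable w : seq nat -> seq nat -> F.

(** The step weight w stays abstract so that [fup] and [fdown] are both instances. *)
Definition chain_weight (d : seq (seq nat)) : F :=
  \prod_(pr <- zip d (behead d)) w pr.1 pr.2.

Definition chain_sum f s t : F := \sum_(d <- chains f s t) chain_weight d.

Lemma chains_head f s t d : d \in chains f s t -> exists d', d = s :: d'.
Proof.
have nil_head : d \in (if s == t then [:: [:: s]] else [::]) -> exists d', d = s :: d'.
  by case: ifP => // _; rewrite inE => /eqP->; exists [::].
case: f => [|f] /=; rewrite mem_cat => /orP[/nil_head //|] //.
by case/flatten_mapP => u _ /mapP[d' _ ->]; exists d'.
Qed.

(** Hence [undup] in [filtrations] removes nothing, and sums over filtrations obey the recursion of
    [chains]. *)
Lemma chains_uniq f s t : uniq (chains f s t).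
Proof.
have nil_uniq r : uniq (if r == t then [:: [:: r]] else [::]) by case: ifP.
elim: f s => [|f IHf] s /=; first by rewrite cats0.
rewrite cat_uniq nil_uniq /=; apply/andP; split.
  apply/hasPn => d /flatten_mapP[u _ /mapP[d' /chains_head[d'' ->] ->]].
  by case: ifP => // _; rewrite inE; apply/eqP => -[].
have : uniq (Mstar s) by exact: undup_uniq.
elim: (Mstar s) => //= u r IHr /andP[u_notin /IHr r_uniq].
rewrite cat_uniq r_uniq map_inj_uniq ?IHf => [|? ? [] //]; rewrite andbT /=.
apply/hasPn => d /flatten_mapP[u' u'_r /mapP[d' /chains_head[d1 ->] ->]].
apply/mapP => -[d2 /chains_head[d3 ->] [eq_u _]].
by case/negP: u_notin; rewrite -eq_u.
Qed.

Lemma chain_sum0 s t : chain_sum 0 s t = (s == t)%:R.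
Proof.
rewrite /chain_sum /= cats0; case: ifP => _; last by rewrite big_nil.
by rewrite big_seq1 /chain_weight /= big_nil.
Qed.

Lemma chain_sumS f s t :
  chain_sum f.+1 s t = (s == t)%:R + \sum_(u <- Mstar s) w s u * chain_sum f u t.
Proof.
rewrite /chain_sum /= big_cat /=; congr (_ + _).
  case: ifP => _; last by rewrite big_nil.
  by rewrite big_seq1 /chain_weight /= big_nil.
rewrite big_flatten big_map; apply: eq_bigr => u _.
rewrite big_map mulr_sumr; apply: eq_big_seq => d /chains_head[d' ->].
by rewrite /chain_weight /= big_cons.
Qed.

(** Each move strictly lowers [nstat], so a filtration from s has at most [nstat s] steps and extra
    fuel adds none. *)
Lemma chain_sum_stable n f s t : s \in partitions n -> (nstat s <= f)%N ->
  chain_sum f.+1 s t = chain_sum f s t.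
Proof.
elim: f s => [|f IHf] s s_part le_sf; rewrite chain_sumS.
  rewrite chain_sum0 big_seq big1 ?addr0 // => u.
  case/(mem_Mstar s_part) => u_part /(dom_lt_nstat s_part u_part); lia.
rewrite [RHS]chain_sumS; congr (_ + _); apply: eq_big_seq => u.
case/(mem_Mstar s_part) => u_part /(dom_lt_nstat s_part u_part) lt_us.
by rewrite IHf //; lia.
Qed.

End Chains.

Lemma sum_Mstar n s (G : seq nat -> F) : s \in partitions n ->
  \sum_(u <- Mstar s) rcoef s u * G u = \sum_(u <- partitions n) rcoef s u * G u.
Proof.
move=> s_part; rewrite [RHS](bigID (mem (Mstar s))) /= [X in _ = _ + X]big1 ?addr0; last first.
  by move=> u u_notin; rewrite (rcoef_notin u_notin) mul0r.
rewrite -[RHS]big_filter; apply: perm_big; apply: uniq_perm.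
- exact: undup_uniq.
- by rewrite filter_uniq // undup_uniq.
by move=> u; rewrite mem_filter andb_idr // => /(mem_Mstar s_part)[].
Qed.

Lemma rcoef_dom_lt n s t : s \in partitions n -> rcoef s t != 0 -> dom_lt s t.
Proof.
move=> s_part r_neq0; have [/(mem_Mstar s_part)[] //|/rcoef_notin r0] := boolP (t \in Mstar s).
by rewrite r0 eqxx in r_neq0.
Qed.

Lemma nstat_bound n s : s \in partitions n -> (nstat s <= n * n)%N.
Proof.
move=> s_part; have [_ _ sum_s] := partitionsP _ _ s_part.
by apply: leq_trans (nstat_le s) _; rewrite sum_s leq_mul2r size_partition ?orbT.
Qed.

Lemma filtrationsE w n s t : s \in partitions n ->
  \sum_(d <- filtrations s t) chain_weight w d = chain_sum w (n * n) s t.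
Proof.
move=> s_part; rewrite /filtrations undup_id ?chains_uniq //.
by have [_ _ ->] := partitionsP _ _ s_part.
Qed.

(** * Unrolling the recursions along filtrations *)

Section TriangularRecursions.
Variables (n : nat) (x : seq nat -> F) (la : seq nat).
Hypothesis la_part : la \in partitions n.

Lemma up_recursion :
  (forall s, s \in partitions n -> ~~ dom_le s la -> x s = 0) ->
  (forall s, s \in partitions n -> (eprime la - eprime s) * x s =
     \sum_(t <- partitions n) rcoef s t * x t) ->
  forall s, s \in partitions n -> x s = x la * \sum_(d <- filtrations s la) fup la d.
Proof.
move=> x0 x_rec; pose w s t := rcoef s t / (eprime la - eprime s).
have step s : s \in partitions n ->
    x s = x la * (s == la)%:R + \sum_(t <- Mstar s) w s t * x t.
  (* At s = la the denominator is 0 and, as the inverse of 0 is 0, so is every weight: only the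
     initial value remains. *)
  move=> s_part; have [->|neq_s] := eqVneq s la.
    rewrite mulr1 big1 ?addr0 // => t _.
    by rewrite /w subrr invr0 mulr0 mul0r.
  rewrite mulr0 add0r; have [le_s|nle_s] := boolP (dom_le s la).
    have e_neq0 : eprime la - eprime s != 0.
      by apply: (dom_lt_eprime s_part la_part); apply/andP.
    apply: (mulfI e_neq0); rewrite (x_rec _ s_part) -(sum_Mstar _ s_part) mulr_sumr.
    apply: eq_bigr => t _; rewrite /w mulrA [_ * (_ / _)]mulrC divfK //.
  rewrite x0 // big_seq big1 // => t /(mem_Mstar s_part)[t_part /andP[le_st _]].
  rewrite x0 ?mulr0 //; apply: contra nle_s; exact: dom_le_trans.
have x_sum f s : s \in partitions n -> (nstat s <= f)%N -> x s = x la * chain_sum w f s la.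
  elim: f s => [|f IHf] s s_part le_sf; rewrite (step s s_part).
    rewrite chain_sum0 big_seq big1 ?addr0 // => u.
    by case/(mem_Mstar s_part) => u_part /(dom_lt_nstat s_part u_part); lia.
  rewrite chain_sumS mulrDr; congr (_ + _); rewrite mulr_sumr; apply: eq_big_seq => u.
  case/(mem_Mstar s_part) => u_part /(dom_lt_nstat s_part u_part) lt_us.
  by rewrite (IHf u) 1?mulrCA //; lia.
move=> s s_part; rewrite (x_sum (n * n)%N s) ?nstat_bound //.
by rewrite -(filtrationsE _ _ s_part).
Qed.

(** With G t the weighted sum over filtrations from t to s, the pairing sum_t x t * G t is expanded
    once by the recursion of G and once by that of x. The resulting double sums coincide, which
    leaves x s = x la * G la. *)
Lemma down_recursion :
  (forall s, s \in partitions n -> ~~ dom_le la s -> x s = 0) ->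
  (forall s, s \in partitions n -> (eprime la - eprime s) * x s =
     \sum_(t <- partitions n) x t * rcoef t s) ->
  forall s, s \in partitions n -> x s = x la * \sum_(d <- filtrations la s) fdown la d.
Proof.
move=> x0 x_rec; pose w s t := rcoef s t / (eprime la - eprime t).
have step s : s \in partitions n ->
    x s = x la * (la == s)%:R + \sum_(t <- partitions n) x t * w t s.
  move=> s_part; have [<-|neq_s] := eqVneq la s.
    rewrite mulr1 big1 ?addr0 // => t _.
    by rewrite /w subrr invr0 !mulr0.
  rewrite mulr0 add0r; have [le_s|nle_s] := boolP (dom_le la s).
    have e_neq0 : eprime la - eprime s != 0.
      by rewrite -opprB oppr_eq0; apply: (dom_lt_eprime la_part s_part); apply/andP.
    apply: (mulfI e_neq0); rewrite (x_rec _ s_part) mulr_sumr.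
    by apply: eq_bigr => t _; rewrite /w [RHS]mulrC -mulrA divfK.
  rewrite x0 // big_seq big1 // => t t_part.
  have [r0|r_neq0] := eqVneq (rcoef t s) 0; first by rewrite /w r0 mul0r mulr0.
  have /andP[le_ts _] := rcoef_dom_lt t_part r_neq0.
  rewrite x0 ?mul0r //; apply: contra nle_s => le_t; exact: dom_le_trans le_t le_ts.
move=> s s_part.
pose G t := chain_sum w (n * n) t s.
have G_rec t : t \in partitions n ->
    G t = (t == s)%:R + \sum_(u <- partitions n) w t u * G u.
  move=> t_part; rewrite /G -(chain_sum_stable _ _ t_part) ?nstat_bound // chain_sumS.
  congr (_ + _); under eq_bigr do rewrite /w -mulrA.
  by rewrite (sum_Mstar _ t_part); apply: eq_bigr => u _; rewrite mulrA.
transitivity (x la * G la); last by rewrite /G -(filtrationsE _ _ la_part).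
have eq1 : \sum_(t <- partitions n) x t * G t =
    x s + \sum_(u <- partitions n) (\sum_(t <- partitions n) x t * w t u) * G u.
  transitivity (\sum_(t <- partitions n) (x t * (t == s)%:R +
      \sum_(u <- partitions n) x t * w t u * G u)).
    apply: eq_big_seq => t t_part; rewrite {1}(G_rec _ t_part) mulrDr mulr_sumr.
    by congr (_ + _); apply: eq_bigr => u _; rewrite mulrA.
  rewrite big_split /=; congr (_ + _).
    rewrite (bigD1_seq s) ?undup_uniq //= eqxx mulr1 big1 ?addr0 // => t /negPf->.
    by rewrite mulr0.
  by rewrite exchange_big; apply: eq_bigr => u _; rewrite mulr_suml.
have eq2 : \sum_(t <- partitions n) x t * G t = x la * G la +
    \sum_(u <- partitions n) (\sum_(t <- partitions n) x t * w t u) * G u.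
  transitivity (\sum_(t <- partitions n) (x la * (la == t)%:R * G t +
      (\sum_(u <- partitions n) x u * w u t) * G t)).
    by apply: eq_big_seq => t t_part; rewrite {1}(step _ t_part) mulrDl.
  rewrite big_split /=; congr (_ + _).
  rewrite (bigD1_seq la) ?undup_uniq //= eqxx mulr1 big1 ?addr0 // => t.
  by rewrite eq_sym => /negPf->; rewrite mulr0 mul0r.
exact: addIr (etrans (esym eq1) eq2).
Qed.

End TriangularRecursions.

(** * Jack functions *)
Section Monomials.
Variable n : nat.

Lemma mdeg_lmon s : s \in partitions n -> mdeg (lmon n s) = n.
Proof.
move=> s_part; have [_ _ sum_s] := partitionsP _ _ s_part.
rewrite mdegE -[RHS]sum_s sumnE (big_nth 0%N) big_mkord.
rewrite (big_ord_widen n (fun i => nth 0%N s i)) ?size_partition //.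
rewrite [RHS]big_mkcond; apply: eq_bigr => i _; rewrite mnmE.
by case: ltnP => // le_i; rewrite nth_default.
Qed.

Lemma mpart_lmon s : s \in partitions n -> mpart (lmon n s) = s.
Proof.
move=> s_part; have [s_sorted s0 _] := partitionsP _ _ s_part; rewrite /mpart.
rewrite (eq_map (_ : _ =1 fun i : 'I_n => nth 0%N s i)); last by move=> i; rewrite mnmE.
rewrite filter_pos_map_nth ?size_partition // filter_pos_id //.
by rewrite sorted_sort //; exact: geq_trans.
Qed.

Lemma mcoeff_mono s t : s \in partitions n -> (mono n t)@_(lmon n s) = (s == t)%:R.
Proof.
move=> s_part; have lt_s : (mdeg (lmon n s) < n.+1)%N by rewrite mdeg_lmon.
rewrite /mono raddf_sum /= (eq_bigr (fun m : 'X_{1..n < n.+1} => (val m == lmon n s)%:R)).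
  rewrite big_mkcond (bigD1 (BMultinom lt_s)) //= eqxx mpart_lmon //.
  rewrite big1 ?addr0 => [|m neq_m]; first by case: ifP.
  by case: ifP => // _; rewrite -val_eqE /= in neq_m; rewrite (negPf neq_m).
by move=> m _; rewrite mcoeffX.
Qed.

End Monomials.

Section Jack.
Variables (n : nat) (P : seq nat -> {mpoly F[n]}).
Hypothesis P_jack : jackP_family P.
Local Notation Pi := (partitions n).

(** The coefficient of m_mu in P_la, taken as a scalar product so that adjointness applies to it
    directly. *)
Definition jack_coef la mu : F := scal (qq n mu) (P la).
Local Notation u := jack_coef.

Lemma jack_coefE la mu : mu \in Pi -> u la mu = (ev (P la))@_(lmon n mu).
Proof. by move=> mu_part; rewrite /u qq_dual ?size_partition. Qed.

Lemma sum_mono (c : seq nat -> F) (p : pred (seq nat)) mu : mu \in Pi ->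
  (\sum_(nu <- Pi | p nu) c nu *: mono n nu)@_(lmon n mu) = if p mu then c mu else 0.
Proof.
move=> mu_part; rewrite raddf_sum /= big_mkcond (bigD1_seq mu) ?undup_uniq //=.
rewrite mcoeffZ mcoeff_mono // eqxx mulr1 big1 ?addr0 // => nu neq_nu.
by rewrite mcoeffZ mcoeff_mono // eq_sym (negPf neq_nu) mulr0 if_same.
Qed.

Lemma jack_coef_tri la mu : la \in Pi -> mu \in Pi -> u la mu != 0 -> dom_le mu la.
Proof.
move=> la_part mu_part; rewrite jack_coefE //.
have [c ->] := P_jack.2.1 la la_part.
rewrite mcoeffD mcoeff_mono // sum_mono //; have [->|_] := eqVneq mu la.
  by rewrite dom_le_refl.
by rewrite add0r; case: ifP => [/andP[]|_]; rewrite ?eqxx.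
Qed.

Lemma jack_coef_diag la : la \in Pi -> u la la = 1.
Proof.
move=> la_part; rewrite jack_coefE //.
have [c ->] := P_jack.2.1 la la_part.
by rewrite mcoeffD mcoeff_mono // sum_mono // /dom_lt eqxx andbF addr0.
Qed.

Lemma scal_span (c : seq nat -> F) la :
  scal (\sum_(nu <- Pi) c nu *: qq n nu) (P la) = \sum_(nu <- Pi) c nu * u la nu.
Proof. by rewrite scal_suml; apply: eq_bigr => nu _; rewrite scalZl. Qed.

(** Back substitution from the lowest partitions upward. Restricting to a down-closed set [D] serves
    [span_up], where the equations hold only on such a set. *)
Lemma unitriangular_ker (D : pred (seq nat)) (c : seq nat -> F) :
  (forall ka la, ka \in Pi -> la \in Pi -> D la -> dom_le ka la -> D ka) ->
  (forall la, la \in Pi -> D la -> \sum_(nu <- Pi) c nu * u la nu = 0) ->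
  forall la, la \in Pi -> D la -> c la = 0.
Proof.
move=> D_down ker_c la; have [k] := ubnP (n * n - nstat la).
elim: k la => // k IHk la lt_k la_part D_la.
have := ker_c la la_part D_la.
rewrite (bigD1_seq la) ?undup_uniq //= jack_coef_diag // mulr1 big_seq_cond.
rewrite big1 ?addr0 // => nu /andP[nu_part neq_nu].
have [->|u_neq0] := eqVneq (u la nu) 0; first by rewrite mulr0.
have le_nu := jack_coef_tri la_part nu_part u_neq0.
rewrite IHk ?mul0r //; last exact: D_down le_nu.
have := dom_lt_nstat nu_part la_part (introT andP (conj le_nu neq_nu)).
have := nstat_bound nu_part; lia.
Qed.

Lemma span_eq0 f : in_span f -> (forall la, la \in Pi -> scal f (P la) = 0) -> f = 0.
Proof.
case=> c -> f_orth; rewrite big_seq big1 // => nu nu_part.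
rewrite (@unitriangular_ker predT c) ?scale0r // => la la_part _.
by rewrite -scal_span f_orth.
Qed.

Lemma jack_span la : la \in Pi -> in_span (P la).
Proof. by move=> la_part; apply: in_span_homog; apply: P_jack.1. Qed.

Lemma jack_orth la mu : la \in Pi -> mu \in Pi -> la != mu -> scal (P la) (P mu) = 0.
Proof. exact: P_jack.2.2. Qed.

(** Otherwise P la would be orthogonal to every P, hence 0, against its leading coefficient 1. *)
Lemma jack_norm_neq0 la : la \in Pi -> scal (P la) (P la) != 0.
Proof.
move=> la_part; apply/eqP => norm0.
have P0 : P la = 0.
  apply: span_eq0 (jack_span la_part) _ => mu mu_part.
  by have [<- //|neq] := eqVneq la mu; exact: jack_orth.
have := jack_coef_diag la_part; rewrite /u P0 scal0r => /eqP.
by rewrite eq_sym oner_eq0.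
Qed.

(** The partitions not above mu form a down-closed set that avoids mu, and on it orthogonality makes
    the pairings with P mu vanish. *)
Lemma span_up mu (c : seq nat -> F) : mu \in Pi ->
  P mu = \sum_(nu <- Pi) c nu *: qq n nu ->
  forall nu, nu \in Pi -> ~~ dom_le mu nu -> c nu = 0.
Proof.
move=> mu_part P_mu; apply: unitriangular_ker => [ka la _ _ nle_la le_ka|ka ka_part nle_ka].
  by apply: contra nle_la => le_mu; exact: dom_le_trans le_mu le_ka.
rewrite -scal_span -P_mu jack_orth //; apply: contra nle_ka => /eqP->.
exact: dom_le_refl.
Qed.

Lemma scal_qq_LB nu la : nu \in Pi -> scal (qq n nu) (LB (P la)) =
  eprime nu * u la nu + \sum_(t <- Pi) rcoef nu t * u la t.
Proof.
move=> nu_part; rewrite -scal_LB (LB_qq nu_part).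
rewrite scalDl scalZl [X in _ + X]scal_suml /jack_coef; congr (_ + _).
by apply: eq_bigr => t _; rewrite scalZl.
Qed.

(** A surviving move term would give nu < t <= la, which is excluded; the diagonal term survives
    only for nu = la. *)
Lemma scal_qq_LB_tri nu la : nu \in Pi -> la \in Pi -> ~~ dom_lt nu la ->
  scal (qq n nu) (LB (P la)) = eprime la * u la nu.
Proof.
move=> nu_part la_part nlt; rewrite scal_qq_LB // big_seq big1 ?addr0 => [|t t_part].
  have [->//|u_neq0] := eqVneq (u la nu) 0; first by rewrite !mulr0.
  have [-> //|neq] := eqVneq nu la; case/negP: nlt.
  by rewrite /dom_lt neq (jack_coef_tri la_part).
have [->|u_neq0] := eqVneq (u la t) 0; first by rewrite mulr0.
have [->|r_neq0] := eqVneq (rcoef nu t) 0; first by rewrite mul0r.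
have le_t := jack_coef_tri la_part t_part u_neq0.
have /andP[le_nu neq_nu] := rcoef_dom_lt nu_part r_neq0.
case/negP: nlt; rewrite /dom_lt (dom_le_trans le_nu le_t) /=.
apply: contra neq_nu => /eqP eq_nu; rewrite -eq_nu in le_t.
by apply/eqP; exact: (dom_le_anti nu_part t_part).
Qed.

(** P mu involves only q's of index nu >= mu, and nu < la would imply mu < la; so [scal_qq_LB_tri]
    applies termwise. *)
Lemma scal_LB_up mu la : mu \in Pi -> la \in Pi -> ~~ dom_lt mu la ->
  scal (P mu) (LB (P la)) = eprime la * scal (P mu) (P la).
Proof.
move=> mu_part la_part nlt; have [c P_mu] := jack_span mu_part.
rewrite P_mu !scal_suml mulr_sumr; apply: eq_big_seq => nu nu_part.
rewrite !scalZl mulrCA.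
have [le_nu|nle_nu] := boolP (dom_le mu nu); last first.
  by rewrite (span_up mu_part P_mu) ?mul0r.
rewrite scal_qq_LB_tri //; apply: contra nlt => /andP[le_la neq_la].
rewrite /dom_lt (dom_le_trans le_nu le_la) /=.
apply: contra neq_la => /eqP eq_mu; rewrite eq_mu in le_nu.
by apply/eqP; exact: (dom_le_anti nu_part la_part).
Qed.

(* The matrix of the self-adjoint operator LB in the orthogonal basis P is
   symmetric and triangular, hence diagonal. *)
Lemma scal_LB_jack mu la : mu \in Pi -> la \in Pi ->
  scal (P mu) (LB (P la)) = eprime la * scal (P mu) (P la).
Proof.
move=> mu_part la_part; have [/andP[le_mu neq_mu]|] := boolP (dom_lt mu la); last first.
  exact: scal_LB_up.
rewrite -scal_LB scalC scal_LB_up //; first by rewrite jack_orth 1?eq_sym // jack_orth // !mulr0.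
apply: contra neq_mu => /andP[le_la _]; apply/eqP.
exact: (dom_le_anti mu_part la_part).
Qed.

Lemma LB_span (f : {mpoly F[n]}) : in_span f -> in_span (LB f).
Proof.
case=> c ->; rewrite LB_sum big_seq; apply: in_span_sum => nu nu_part.
apply: in_spanZ; rewrite LB_qq //.
have sum_nu := partitionsP _ _ nu_part; apply: in_spanD.
  by apply: in_spanZ; apply: in_span_qq; case: sum_nu.
by exists (rcoef nu).
Qed.

Lemma LB_jack la : la \in Pi -> LB (P la) = eprime la *: P la.
Proof.
move=> la_part; apply/eqP; rewrite -subr_eq0; apply/eqP; apply: span_eq0.
  rewrite -scaleN1r; apply: in_spanD; first exact: LB_span (jack_span la_part).
  by do 2!apply: in_spanZ; exact: jack_span.
move=> mu mu_part; rewrite scalBl scalZl scalC scal_LB_jack // (scalC (P mu)).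
by rewrite subrr.
Qed.

Lemma jack_coef_rec la s : la \in Pi -> s \in Pi ->
  (eprime la - eprime s) * u la s = \sum_(t <- Pi) rcoef s t * u la t.
Proof.
move=> la_part s_part; have := scal_qq_LB la s_part.
rewrite LB_jack // scalZr -/(u la s) => eq_u.
by rewrite [LHS](mulrBl (u la s) (eprime la)) eq_u addrAC subrr add0r.
Qed.

(** The defects [b] are the q-coefficients of e'_mu P_mu - LB P_mu, which is 0. They pair to 0 with
    every P la, and [unitriangular_ker] makes each of them vanish. *)
Lemma q_coef_rec mu (c : seq nat -> F) s : mu \in Pi -> s \in Pi ->
  P mu = \sum_(nu <- Pi) c nu *: qq n nu ->
  (eprime mu - eprime s) * c s = \sum_(t <- Pi) c t * rcoef t s.
Proof.
move=> mu_part s_part P_mu; apply/eqP; rewrite -subr_eq0; apply/eqP.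
pose b s := (eprime mu - eprime s) * c s - \sum_(t <- Pi) c t * rcoef t s.
rewrite -/(b s); apply: (@unitriangular_ker predT b) => // la la_part _.
have : scal (eprime mu *: P mu - LB (P mu)) (P la) = 0.
  by rewrite LB_jack // subrr scalC scal0r.
rewrite scalBl scalZl scal_LB {1}P_mu scal_span.
rewrite {1}P_mu scal_suml => eq0; rewrite -[RHS]eq0.
have -> : \sum_(nu <- Pi) scal (c nu *: qq n nu) (LB (P la)) =
    \sum_(nu <- Pi) c nu * (eprime nu * u la nu) +
    \sum_(nu <- Pi) \sum_(t <- Pi) c t * (rcoef t nu * u la nu).
  rewrite exchange_big -big_split /=; apply: eq_big_seq => nu nu_part.
  by rewrite scalZl scal_qq_LB // mulrDr [X in _ + X = _]mulr_sumr.
rewrite mulr_sumr opprD addrA -!sumrB.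
apply: eq_bigr => nu _; rewrite /b (mulrBl (u la nu)) (mulrBl (c nu) (eprime mu)).
rewrite (mulrBl (u la nu) (eprime mu * c nu)); congr (_ - _ - _).
- by rewrite mulrA.
- by rewrite mulrCA mulrA.
- by rewrite mulr_suml; apply: eq_bigr => t _; rewrite mulrA.
Qed.

End Jack.

Unset Implicit Arguments.

Theorem theorem5p13 (n : nat) (P : seq nat -> {mpoly F[n]})
    (v C : seq nat -> seq nat -> F) :
  jackP_family P ->
  (forall la, la \in partitions n ->
     ev (Jj P la) = \sum_(mu <- partitions n) v la mu *: mono n mu) ->
  (forall mu, mu \in partitions n ->
     Qj P mu = \sum_(la <- partitions n) C mu la *: qq n la) ->
  forall la mu, la \in partitions n -> mu \in partitions n -> dom_lt mu la ->
    v la mu = v la la * \sum_(d <- filtrations mu la) fup la d /\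
    C mu la = C mu mu * \sum_(d <- filtrations mu la) fdown mu d.
Proof.
move=> P_jack J_v Q_C la mu la_part mu_part _.
split.
  (* By duality the coefficients of J la are its pairings with the q's, so they inherit the
     recursion of P la by scaling. *)
  have v_coef s : s \in partitions n -> v la s = jprod la * jack_coef P la s.
    move=> s_part; rewrite -scalZr -/(Jj P la) qq_dual ?size_partition // J_v //.
    by rewrite sum_mono.
  apply: (up_recursion la_part) => // [s s_part nle_s|s s_part].
    rewrite v_coef //; have [->|u_neq0] := eqVneq (jack_coef P la s) 0.
      by rewrite mulr0.
    by case/negP: nle_s; exact: jack_coef_tri u_neq0.
  rewrite v_coef // mulrCA jack_coef_rec // mulr_sumr; apply: eq_big_seq => t t_part.
  by rewrite v_coef // mulrCA.
(* Q mu is P mu divided by N, so the N * C mu s are the q-coefficients of P mu; N is nonzero and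
   cancels from the recursion. *)
pose N := scal (P mu) (P mu); pose c s := N * C mu s.
have N_neq0 : N != 0 by exact: jack_norm_neq0.
have P_mu : P mu = \sum_(s <- partitions n) c s *: qq n s.
  under eq_bigr do rewrite -scalerA.
  by rewrite -scaler_sumr -Q_C // /Qj scalerA mulfV // scale1r.
apply: (down_recursion mu_part) => // [s s_part nle_s|s s_part].
  apply: (mulfI N_neq0); rewrite mulr0; exact: (span_up P_jack mu_part P_mu).
apply: (mulfI N_neq0); rewrite mulrCA (q_coef_rec P_jack mu_part s_part P_mu).
by rewrite mulr_sumr; apply: eq_bigr => t _; rewrite mulrA.
Qed.
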